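(* Let $\mathcal A$ be a countable algebra of subsets of a set $T$, and let $(\mathcal F_A)_{A\in\mathcal A}$ be a family of sub-$\sigma$-fields on a probability space $(\Omega,\mathcal F,P)$ such that for all disjoint $A,B\in\mathcal A$ the $\sigma$-fields $\mathcal F_A,\mathcal F_B$ are independent and together generate $\mathcal F_{A\cup B}$. Then the $\sigma$-field generated by $H_1$ is equal to $\mathcal F_{\text{stable}}$.
   Context: All sub-$\sigma$-fields are understood modulo null sets: every sub-$\sigma$-field contains all $P$-null sets of $\mathcal F$, and generated $\sigma$-fields are understood to include them. $L_2(\mathcal G)$ denotes the real Hilbert space $L_2(\Omega,\mathcal G,P)$. For $A\in\mathcal A$, $E_A:L_2(\mathcal F_T)\to L_2(\mathcal F_T)$ is $E_A X=\mathbb E(X\mid\mathcal F_A)$. For a finite subalgebra $\mathcal B\subset\mathcal A$ with atoms $a_1,\dots,a_r$ and $p\in[0,1]$, let $\mu_p^{\mathcal B}$ be the probability measure on the finite set $\mathcal B$ assigning to $A=a_{k_1}\cup\dots\cup a_{k_n}$ ($k_1<\dots<k_n$) the mass $p^n(1-p)^{r-n}$. Choose finite subalgebras $\mathcal A_1\subset\mathcal A_2\subset\cdots$ with $\bigcup_m\mathcal A_m=\mathcal A$; for $t\ge0$ put $U_t^{(m)}=\sum_{A\in\mathcal A_m}\mu_{e^{-t}}^{\mathcal A_m}(A)\,E_A$ on $L_2(\mathcal F_T)$. The strong limit $U_t=\lim_{m\to\infty}U_t^{(m)}$ exists, does not depend on the choice of $(\mathcal A_m)$, and satisfies $U_sU_t=U_{s+t}$,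 $\|U_t\|\le1$. $\mathcal F_{\text{stable}}\subset\mathcal F_T$ is the sub-$\sigma$-field such that, for $X\in L_2(\mathcal F_T)$: $X\in L_2(\mathcal F_{\text{stable}})$ if and only if $\|X-U_tX\|\to0$ as $t\to0$ (it is the $\sigma$-field generated by all such $X$). $H_1=\{X\in L_2(\mathcal F_{\text{stable}}):U_tX=e^{-t}X\text{ for all }t\ge0\}$. *)

(* Defs.v *)
From HB Require Import structures.
From mathcomp Require Import all_boot all_order all_algebra finmap.
From mathcomp Require Import all_classical all_reals all_analysis.

Set Implicit Arguments.
Unset Strict Implicit.
Unset Printing Implicit Defensive.
Import Order.TTheory GRing.Theory Num.Theory.
Import numFieldNormedType.Exports.

Local Open Scope classical_set_scope.
Local Open Scope ring_scope.

Section algebras_of_sets.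
Context {T : Type}.

Definition set_algebra (B : set (set T)) : Prop :=
  [/\ B set0, setU_closed B & setC_closed B].

Definition atoms (B : set (set T)) : set (set T) :=
  [set a | [/\ B a, a !=set0 &
              forall b, B b -> b `<=` a -> b = set0 \/ b = a]].

(* Each atom of B is kept with probability p, independently of the others:
   this is the probability that the union of the kept atoms is a.  Meaningful
   for a finite algebra B and a in B only. *)
Definition atom_weight {R : realType} (p : R) (B : set (set T)) (a : set T)
    : R :=
  let r := #|` fset_set (atoms B)| in
  let n := #|` fset_set [set b | atoms B b /\ b `<=` a]| in
  p ^+ n * (1 - p) ^+ (r - n).

Definition exhaustion (A : set (set T)) (Am : nat -> set (set T)) : Prop :=
  [/\ forall m, set_algebra (Am m) /\ finite_set (Am m),
      forall m, Am m `<=` Am m.+1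
    & \bigcup_m Am m = A].

End algebras_of_sets.

Section sigma_fields.
Context {R : realType} {d : measure_display} {Omega : measurableType d}.
Variable P : probability Omega R.

Definition null_sets : set (set Omega) :=
  [set N | measurable N /\ P N = 0%E].

Definition sub_sigma_field (G : set (set Omega)) : Prop :=
  [/\ sigma_algebra setT G, G `<=` measurable & null_sets `<=` G].

Definition gen_sigma_field (C : set (set Omega)) : set (set Omega) :=
  <<s C `|` null_sets >>.

Definition independent_fields (G1 G2 : set (set Omega)) : Prop :=
  forall B C, G1 B -> G2 C -> P (B `&` C) = (P B * P C)%E.

Definition measurable_wrt (G : set (set Omega)) (X : Omega -> R) : Prop :=
  measurable_fun [set: g_sigma_algebraType G] (X : g_sigma_algebraType G -> R).

Definition sigma_field_of (H : set (Omega -> R)) : set (set Omega) :=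
  gen_sigma_field (\bigcup_(X in H) preimage_set_system setT X measurable).

(* Elements of L_2 are represented by square integrable functions; equality in
   L_2 is almost sure equality.  As a sub-sigma-field G contains the null
   sets, any measurable function a.s. equal to an element of L2 G is in L2 G. *)
Definition L2 (G : set (set Omega)) : set (Omega -> R) :=
  [set X | X \in Lfun P 2%:E /\ measurable_wrt G X].

Definition L2dist (X Y : Omega -> R) : \bar R :=
  ('N[P]_(2%:E)[EFin \o (X \- Y)%R])%E.

Definition is_cond_exp (G : set (set Omega)) (X Y : Omega -> R) : Prop :=
  [/\ measurable_wrt G Y, P.-integrable setT (EFin \o Y)
    & forall B, G B ->
        (\int[P]_(w in B) (Y w)%:E = \int[P]_(w in B) (X w)%:E)%E].

(* A version of E(X | G). *)
Definition cond_exp (G : set (set Omega)) (X : Omega -> R) : Omega -> R :=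
  xget (cst 0) [set Y | is_cond_exp G X Y].

End sigma_fields.

Section semigroup.
Context {R : realType} {d : measure_display} {Omega : measurableType d}.
Variable P : probability Omega R.
Context {T : Type}.
Variables (F : set T -> set (set Omega)) (Am : nat -> set (set T)).

Definition Uapprox (m : nat) (t : R) (X : Omega -> R) : Omega -> R :=
  fun w => \sum_(a \in Am m)
             atom_weight (expR (- t)) (Am m) a * cond_exp P (F a) X w.

(* A version of the limit in L_2(F_T). *)
Definition U (t : R) (X : Omega -> R) : Omega -> R :=
  xget (cst 0) [set Y | L2 P (F setT) Y /\
                        L2dist P (Uapprox m t X) Y @[m --> \oo] --> 0%E].

Definition F_stable : set (set Omega) :=
  sigma_field_of P
    [set X | L2 P (F setT) X /\ L2dist P X (U t X) @[t --> 0^'+] --> 0%E].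

Definition H1 : set (Omega -> R) :=
  [set X | L2 P F_stable X /\
           forall t : R, 0 <= t -> U t X = (fun w => expR (- t) * X w) %[ae P]].

End semigroup.

(* Main.v *)
Require Import Defs.
From HB Require Import structures.
From mathcomp Require Import all_boot all_order all_algebra finmap.
From mathcomp Require Import all_classical all_reals all_analysis.
From mathcomp Require Import measurable_realfun ring lra.

(** On a finite subalgebra with atoms a_1, ..., a_r, the commuting projections
    E_A decompose X into orthogonal components X_S indexed by the sets S of atoms,
    and the approximation of U_t multiplies X_S by e^(-t |S|).  Under refinement
    |S| can only grow.  Let X be stable.  Comparing U_t with its approximations
    shows that X is the limit in m of its parts Y_m in which no atom of A_m is hit
    by more than one point of the spectral set (and Y_m itself is a limit over
    finer and finer subalgebras).  If a is an atom of A_m and B is in F_(~a), then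
    E_a (1_B Y_m) is, up to its mean, additive over the subsets of a, and additive
    elements are exactly what H_1 consists of; hence Y_m is measurable with respect
    to F_(~a) and the additive elements in F_a.  Doing this for one atom after the
    other makes Y_m, hence X, measurable with respect to the field generated by
    H_1.  The other inclusion is immediate. *)

Set Implicit Arguments.
Unset Strict Implicit.
Unset Printing Implicit Defensive.
Import Order.TTheory GRing.Theory Num.Theory.
Import numFieldNormedType.Exports.

Local Open Scope classical_set_scope.
Local Open Scope ring_scope.

(** Additivity on [a] is tested by arbitrary members of [A], whereas a part of X cut out at one
    finite level is controlled only against sets of that level; this is what forces the passage to
    the limit in the construction of Y_m. Conditions such as [sparse] are written as identities of
    inner products so that they survive this limit, and no spectral measure is built: each spectral
    statement is a comparison of coefficients on finitely many sets of atoms. Time and level are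
    decoupled. A time t is fixed first, with the squared distance from X to U_t X below eps/4. The
    squared distance from X to Y_m is then at most four times this, plus the squared distance from
    U_t^(m) X to U_t X times a factor that explodes as t tends to 0 but does not depend on m; only
    then does m grow. Vectors are functions, so the inner product is only semi-definite. Equality in
    L_2 reads [nsq (x - y) = 0] and is mostly proved by testing against all vectors or against
    indicators. *)

(** * Semi-inner products *)

Section semi_inner_product.
Context {R : realType} {V : lmodType R} (ip : V -> V -> R).

Definition semi_inner : Prop :=
  [/\ forall x y, ip x y = ip y x,
      forall a x y z, ip (a *: x + y) z = a * ip x z + ip y z
    & forall x, 0 <= ip x x].

Definition nsq (x : V) : R := ip x x.

Definition nsq_cauchy (x : nat -> V) : Prop :=
  forall e : R, 0 < e -> exists N, forall n m, (N <= n)%N -> (N <= m)%N ->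
    nsq (x n - x m) < e.

(** Closedness and completeness in one notion, so that the projection theorem can be stated for [W]
    inside an arbitrary semi-inner product space. *)
Definition nsq_closed (W : set V) : Prop :=
  forall x : nat -> V, (forall n, W (x n)) -> nsq_cauchy x ->
    exists2 y, W y & nsq (x n - y) @[n --> \oo] --> 0.

Hypothesis ipP : semi_inner.

Lemma ipC x y : ip x y = ip y x. Proof. by case: ipP => + _ _; apply. Qed.

Lemma nsq_ge0 x : 0 <= nsq x. Proof. by case: ipP => _ _; apply. Qed.

Lemma ip_linear z : linear_for *%R (ip ^~ z).
Proof. by move=> a x y; case: ipP => _ + _; apply. Qed.

Lemma ip0l z : ip 0 z = 0.
Proof. by have := ip_linear z (-1) 0 0; rewrite scaler0 addr0; lra. Qed.

Lemma ipDl x y z : ip (x + y) z = ip x z + ip y z.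
Proof. by have := ip_linear z 1 x y; rewrite scale1r mul1r. Qed.

Lemma ipZl a x z : ip (a *: x) z = a * ip x z.
Proof. by have := ip_linear z a x 0; rewrite addr0 ip0l addr0. Qed.

Lemma ipNl x z : ip (- x) z = - ip x z.
Proof. by rewrite -scaleN1r ipZl mulN1r. Qed.

Lemma ipBl x y z : ip (x - y) z = ip x z - ip y z.
Proof. by rewrite ipDl ipNl. Qed.

Lemma ipDr x y z : ip z (x + y) = ip z x + ip z y.
Proof. by rewrite ipC ipDl !(ipC _ z). Qed.

Lemma ipZr a x z : ip z (a *: x) = a * ip z x.
Proof. by rewrite ipC ipZl (ipC x). Qed.

Lemma ipBr x y z : ip z (x - y) = ip z x - ip z y.
Proof. by rewrite ipC ipBl !(ipC _ z). Qed.

Lemma ip_suml (J : Type) (r : seq J) (Q : pred J) (x : J -> V) z :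
  ip (\sum_(j <- r | Q j) x j) z = \sum_(j <- r | Q j) ip (x j) z.
Proof.
by apply: (big_morph (ip ^~ z)) => [u v|]; [rewrite ipDl|rewrite ip0l].
Qed.

Lemma nsqD x y : nsq (x + y) = nsq x + 2 * ip x y + nsq y.
Proof. by rewrite /nsq ipDl !ipDr (ipC y x); lra. Qed.

Lemma nsqB x y : nsq (x - y) = nsq x - 2 * ip x y + nsq y.
Proof. by rewrite /nsq ipBl !ipBr (ipC y x); lra. Qed.

Lemma nsqZ a x : nsq (a *: x) = a ^+ 2 * nsq x.
Proof. by rewrite /nsq ipZl ipZr mulrA expr2. Qed.

Lemma nsqN x : nsq (- x) = nsq x.
Proof. by rewrite -scaleN1r nsqZ sqrrN expr1n mul1r. Qed.

Lemma nsqBC x y : nsq (x - y) = nsq (y - x).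
Proof. by rewrite -opprB nsqN. Qed.

Lemma cauchy_schwarz x y : ip x y ^+ 2 <= nsq x * nsq y.
Proof.
have [y0|y0] := eqVneq (nsq y) 0.
  rewrite y0 mulr0; have [->|xy0] := eqVneq (ip x y) 0; first by rewrite expr0n.
  (* A null vector [y] could still pair with [x]; this coefficient would make the square equal to
     [-1]. *)
  have := nsq_ge0 (x - ((nsq x + 1) / (2 * ip x y)) *: y).
  rewrite nsqB ipZr nsqZ y0 mulr0 addr0.
  by rewrite (_ : 2 * _ = nsq x + 1); [lra|field].
have ygt0 : 0 < nsq y by rewrite lt_def y0 nsq_ge0.
have := nsq_ge0 (x - (ip x y / nsq y) *: y).
rewrite nsqB ipZr nsqZ.
rewrite (_ : _ + _ = nsq x - ip x y ^+ 2 / nsq y); last by field.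
by rewrite subr_ge0 ler_pdivrMr.
Qed.

Lemma nsq0_ip x z : nsq x = 0 -> ip x z = 0.
Proof.
move=> x0; apply/eqP; rewrite -sqrf_eq0 eq_le sqr_ge0 andbT.
by rewrite (le_trans (cauchy_schwarz _ _))// x0 mul0r.
Qed.

Lemma nsqB0_ip x y z : nsq (x - y) = 0 -> ip x z = ip y z.
Proof. by move=> /(nsq0_ip z)/eqP; rewrite ipBl subr_eq0 => /eqP. Qed.

Lemma ip_eq_nsqB0 x y : (forall z, ip x z = ip y z) -> nsq (x - y) = 0.
Proof. by move=> xy; rewrite /nsq ipBl xy subrr. Qed.

Lemma cvg_ip (x : nat -> V) y z :
  nsq (x n - y) @[n --> \oo] --> 0 -> ip (x n) z @[n --> \oo] --> ip y z.
Proof.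
move=> /cvgrPdist_lt xy; apply/cvgrPdist_lt => e e0.
have z1 : 0 < nsq z + 1 by rewrite ltr_wpDl ?nsq_ge0.
have := xy (e ^+ 2 / (nsq z + 1)); rewrite divr_gt0 ?exprn_gt0// => /(_ isT).
apply: filterS => n /=; rewrite sub0r normrN ger0_norm ?nsq_ge0//.
rewrite ltr_pdivlMr// => xn.
rewrite -ltr_sqr ?nnegrE ?(ltW e0)// real_normK ?num_real//.
rewrite -ipBl (le_lt_trans (cauchy_schwarz _ _))// -[nsq (y - _)]nsqBC.
by rewrite (le_lt_trans _ xn)// ler_wpM2l ?nsq_ge0// lerDl.
Qed.

Lemma cvg_nsqB (x : nat -> V) y z :
  nsq (x n - y) @[n --> \oo] --> 0 -> nsq (z - x n) @[n --> \oo] --> nsq (z - y).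
Proof.
move=> xy.
have -> : (fun n => nsq (z - x n)) =
   (fun n => (nsq (x n - y) - 2 * ip (x n) (z - y)) + (nsq z - nsq y)).
  by apply/funext => n; rewrite !nsqB ipBr (ipC z (x n)); lra.
have -> : nsq (z - y) = (0 - 2 * ip y (z - y)) + (nsq z - nsq y).
  by rewrite nsqB ipBr (ipC z y) /nsq; lra.
apply: cvgD; last exact: cvg_cst.
by apply: cvgB => //; apply: cvgMr; exact: cvg_ip.
Qed.

Lemma nsqB_cvg_le (x : nat -> V) y z (c : R) :
  nsq (x n - y) @[n --> \oo] --> 0 ->
  (\forall n \near \oo, nsq (z - x n) <= c) -> nsq (z - y) <= c.
Proof.
move=> xy0 xc; have xy := cvg_nsqB (z := z) xy0; rewrite -(cvg_lim _ xy)//.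
by apply: limr_le => //; apply/cvg_ex; eexists; exact: xy.
Qed.

(** The hypothesis is Pythagoras for successive orthogonal projections. The squared norms decrease,
    hence converge, and their gaps are the squared distances. *)
Lemma nsq_decreasing_cauchy (x : nat -> V) :
  (forall n m, (n <= m)%N -> nsq (x n - x m) = nsq (x n) - nsq (x m)) ->
  nsq_cauchy x.
Proof.
move=> xd e e0.
have dec : {homo (fun n => nsq (x n)) : n m / (n <= m)%N >-> m <= n}.
  by move=> n m nm; rewrite -subr_ge0 -xd// nsq_ge0.
have /cvg_ex[l /cvgrPdist_lt /(_ (e / 2))] : cvgn (fun n => nsq (x n)).
  apply: nonincreasing_is_cvgn => //.
  by exists 0 => _ [n _ <-]; exact: nsq_ge0.
rewrite divr_gt0// => /(_ isT)[N _ Ne]; exists N.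
have main n m : (N <= n)%N -> (n <= m)%N -> nsq (x n - x m) < e.
  move=> Nn nm; rewrite xd//.
  have := Ne n Nn; have := Ne m (leq_trans Nn nm) => /=.
  by rewrite !ltr_norml => /andP[? ?] /andP[? ?]; lra.
move=> n m Nn Nm; have [nm|/ltnW mn] := leqP n m; first exact: main.
by rewrite nsqBC; exact: main.
Qed.

(** A minimizing sequence is Cauchy by the parallelogram identity at midpoints, and its limit
    attains the distance. *)
Lemma orthogonal_projection (W : set V) (x : V) :
  W 0 -> (forall a y z, W y -> W z -> W (a *: y + z)) -> nsq_closed W ->
  exists2 y, W y & forall z, W z -> ip (x - y) z = 0.
Proof.
move=> W0 WD Wc.
pose D := [set nsq (x - y) | y in W].
have D0 : D !=set0 by exists (nsq (x - 0)); exists 0.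
have Dlb : has_lbound D by exists 0 => _ [y _ <-]; exact: nsq_ge0.
have Dge y : W y -> inf D <= nsq (x - y).
  by move=> Wy; apply: ge_inf => //; exists y.
have /choice[u /all_and2[Wu ud]] : forall n :
  nat, exists y, W y /\ nsq (x - y) < inf D + n.+1%:R^-1.
  move=> n; have n0 : 0 < n.+1%:R^-1 :> R by rewrite invr_gt0.
  have [_ [y Wy <-] lt] := inf_adherent n0 (conj D0 Dlb).
  by exists y.
have uc : nsq_cauchy u.
  move=> e e0; have e8 : 0 < e / 8 by rewrite divr_gt0.
  have [N _ NP] := near_infty_natSinv_lt (PosNum e8).
  exists N => n m Nn Nm.
  have := NP n Nn; have := NP m Nm => /= nle mle.
  have := Dge (2^-1 *: (u n) + 2^-1 *: (u m)).
  have Wm : W (2^-1 *: u n + 2^-1 *: u m).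
    by apply: (WD) => //; rewrite -[X in W X]addr0; apply: (WD).
  move=> /(_ Wm).
  have -> : nsq (x - (2^-1 *: u n + 2^-1 *: u m)) =
     2^-1 * nsq (x - u n) + 2^-1 * nsq (x - u m) - 4^-1 * nsq (u n - u m).
    by rewrite !nsqB nsqD !nsqZ ipDr !ipZr ipZl; field.
  have un := lt_trans (ud n) (etrans (ltrD2l (inf D) _ _) mle).
  have um := lt_trans (ud m) (etrans (ltrD2l (inf D) _ _) nle).
  by move: un um => /= un um h; lra.
have [y Wy uy] := Wc _ Wu uc.
exists y => //.
have xy : nsq (x - y) <= inf D.
  apply/ler_addgt0Pr => e e0.
  apply: (nsqB_cvg_le uy).
  have [N _ NP] := near_infty_natSinv_lt (PosNum e0).
  exists N => // n Nn /=; rewrite ltW//.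
  exact: (lt_trans (ud n) (etrans (ltrD2l (inf D) _ _) (NP n Nn))).
move=> z Wz; have [z0|z0] := eqVneq (nsq z) 0.
  by rewrite ipC nsq0_ip.
have zgt0 : 0 < nsq z by rewrite lt_def z0 nsq_ge0.
(* The best shift along [z] lowers the squared distance by [ip (x - y) z ^+ 2 / nsq z], which
   minimality forces to be 0. *)
have := Dge _ (WD (ip (x - y) z / nsq z) _ _ Wz Wy).
move=> /(le_trans xy).
rewrite opprD addrA addrAC [leRHS]nsqB ipZr nsqZ => h.
have : ip (x - y) z ^+ 2 / nsq z <= 0.
  have -> : ip (x - y) z ^+ 2 / nsq z =
    2 * (ip (x - y) z / nsq z * ip (x - y) z) - (ip (x - y) z / nsq z)
      ^+ 2 * nsq z by field.
  by lra.
rewrite pmulr_lle0 ?invr_gt0// => h2.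
by apply/eqP; rewrite -sqrf_eq0 eq_le h2 sqr_ge0.
Qed.

End semi_inner_product.

(** * Square integrable functions *)

Definition le12 {R : realType} : (1 <= 2%:E :> \bar R)%E := lee1n 2.

Notation sqint P := (LfunType P le12).

(* The constructions below are sealed, so that comparing two elements of L_2
   never unfolds the underlying functions. *)
HB.lock Definition mk_sqint {R : realType} {d : measure_display}
    {Omega : measurableType d} (P : probability Omega R) (X : Omega -> R) : sqint P :=
  insubd (0 : sqint P) X.

HB.lock Definition inner {R : realType} {d : measure_display}
    {Omega : measurableType d} (P : probability Omega R) (X Y : sqint P) : R :=
  \int[P]_w (X w * Y w).

HB.lock Definition restr {R : realType} {d : measure_display}
    {Omega : measurableType d} (P : probability Omega R) (B : set Omega)
    (X : sqint P) : sqint P :=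
  mk_sqint P (fun w => X w * \1_B w).

HB.lock Definition sqint1 {R : realType} {d : measure_display}
    {Omega : measurableType d} (P : probability Omega R) : sqint P :=
  mk_sqint P (cst 1).

Arguments inner {R d Omega P} X Y.
Arguments restr {R d Omega P} B X.

Section square_integrable.
Context {R : realType} {d : measure_display} {Omega : measurableType d}.
Variable P : probability Omega R.

Local Notation sqint := (sqint P).

Local Notation mk_sqint := (mk_sqint P).
Local Notation inner := (@inner _ _ _ P).
Local Notation restr := (@restr _ _ _ P).
Local Notation sqint1 := (sqint1 P).

Lemma innerE (X Y : sqint) : inner X Y = \int[P]_w (X w * Y w).
Proof. by rewrite inner.unlock. Qed.

Lemma sqint_Lfun (X : sqint) : (X : Omega -> R) \in Lfun P 2%:E.
Proof. exact: LfunP. Qed.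

Lemma mk_sqintE (X : Omega -> R) :
  X \in Lfun P 2%:E -> mk_sqint X = X :> (Omega -> R).
Proof. by move=> LX; rewrite mk_sqint.unlock; exact: (insubdK (0 : sqint) LX). Qed.

Lemma sqintDE (X Y : sqint) w : (X + Y) w = X w + Y w. Proof. by []. Qed.
Lemma sqintZE a (X : sqint) w : (a *: X) w = a * X w. Proof. by []. Qed.

Lemma sqint_measurable (X : sqint) : measurable_fun setT X.
Proof. by have /andP[/[!inE]] := sqint_Lfun X. Qed.
Hint Resolve sqint_measurable : core.

Lemma sqint_mul_integrable (X Y : sqint) :
  P.-integrable setT (EFin \o (fun w => X w * Y w)).
Proof.
by apply/Lfun1_integrable; exact: (Lfun2_mul_Lfun1 (sqint_Lfun X) (sqint_Lfun Y)).
Qed.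

Lemma Lfun2P (X : Omega -> R) : measurable_fun setT X ->
  (\int[P]_w ((X w) ^+ 2)%:E < +oo)%E -> X \in Lfun P 2%:E.
Proof.
move=> mX X2; rewrite inE; apply/andP; split; rewrite inE//= /finite_norm unlock.
rewrite poweR_lty// (le_lt_trans _ X2)//.
by under eq_integral do rewrite /= powR_mulrn ?real_normK ?num_real//.
Qed.

Lemma inner_semi_inner : semi_inner inner.
Proof.
split.
- by move=> X Y; rewrite !innerE; apply: eq_Rintegral => w _; rewrite mulrC.
- move=> a X Y Z; rewrite !innerE -RintegralZl//; last exact: sqint_mul_integrable.
  rewrite -RintegralD//; last 2 first.
  + rewrite (_ : _ \o _ = EFin \o (fun w => (a *: X) w * Z w)).
      exact: sqint_mul_integrable.
    by apply/funext => w; congr EFin; exact: mulrA.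
  + exact: sqint_mul_integrable.
  + by apply: eq_Rintegral => w _; rewrite sqintDE sqintZE mulrDl mulrA.
- by move=> X; rewrite innerE; apply: Rintegral_ge0 => w _; rewrite -expr2 sqr_ge0.
Qed.

Lemma nsqE (X : sqint) : (nsq inner X)%:E = (\int[P]_w ((X w) ^+ 2)%:E)%E.
Proof.
rewrite /nsq innerE /Rintegral; under eq_integral do rewrite -expr2.
rewrite fineK//; have := sqint_mul_integrable X X.
by under eq_fun do rewrite -expr2; exact: integrable_fin_num.
Qed.

Lemma L2distE (X Y : sqint) :
  L2dist P X Y = (Num.sqrt (nsq inner (X - Y)))%:E.
Proof.
rewrite /L2dist unlock.
under eq_integral do rewrite /= powR_mulrn// real_normK ?num_real//.
by rewrite -[X in (X `^ _)%E](nsqE (X - Y)) poweR_EFin powR12_sqrt ?nsq_ge0//;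
  exact: inner_semi_inner.
Qed.

Lemma nsq0_ae (X : sqint) : nsq inner X = 0 -> {ae P, forall w, X w = 0}.
Proof.
move=> X0; have m2 : measurable_fun setT (EFin \o (fun w =>
  X w ^+ 2) : Omega -> \bar R).
  by apply/measurable_EFinP; apply: measurable_funX.
have /(ae_eq_integral_abs P measurableT m2) : (\int[P]_w `|((X w) ^+ 2)%:E| = 0)%E.
  rewrite -[RHS](congr1 EFin X0) nsqE.
  by apply: eq_integral => w _; rewrite gee0_abs// lee_fin sqr_ge0.
apply: filterS => w /(_ I)/=; case=> /eqP.
by rewrite sqrf_eq0 => /eqP.
Qed.

Lemma ae_nsq0 (X : sqint) : {ae P, forall w, X w = 0} -> nsq inner X = 0.
Proof.
move=> X0; apply: EFin_inj; rewrite nsqE -[RHS](integral0 P setT).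
apply: ae_eq_integral => //.
  apply/measurable_EFinP; exact: measurable_funX.
by apply: filterS X0 => w X0 _ /=; rewrite X0 expr0n.
Qed.

Lemma nsqB0_ae (X Y : sqint) : nsq inner (X - Y) = 0 <-> X = Y %[ae P].
Proof.
split=> [/nsq0_ae|XY]; last first.
  apply: ae_nsq0; apply: filterS XY => w /(_ I) XY.
  by rewrite -[LHS]/(X w - Y w) XY subrr.
apply: filterS => w; rewrite -[(X - Y) w]/(X w - Y w) => /eqP XY _.
by apply/eqP; rewrite -subr_eq0.
Qed.

Lemma restrE B X : measurable B -> restr B X = (fun w => X w * \1_B w) :> (_ -> _).
Proof.
move=> mB; rewrite restr.unlock; apply: mk_sqintE; apply: Lfun2P.
  by apply: measurable_funM => //; exact: measurable_indic.
have := integrable_lty measurableT (sqint_mul_integrable X X).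
apply: le_lt_trans; apply: ge0_le_integral => //.
- by move=> w _; rewrite lee_fin sqr_ge0.
- apply/measurable_EFinP; apply: measurable_funX.
  by apply: measurable_funM => //; exact: measurable_indic.
- by apply/measurable_EFinP; exact: measurable_funM.
- by move=> w _; rewrite lee_fin exprMn -expr2 ler_piMr ?sqr_ge0//.
Qed.

Lemma inner_restr B X Y : measurable B ->
  inner (restr B X) Y = inner X (restr B Y).
Proof.
move=> mB; rewrite !innerE !restrE//.
by apply: eq_Rintegral => w _; rewrite mulrAC mulrA.
Qed.

Lemma sqint1E : sqint1 = cst 1 :> (_ -> _).
Proof. by rewrite sqint1.unlock; apply: mk_sqintE; exact: Lfun_cst. Qed.

Definition ind (B : set Omega) : sqint := restr B sqint1.

Lemma indE B : measurable B -> ind B = \1_B :> (_ -> _).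
Proof. by move=> mB; rewrite restrE// sqint1E; apply/funext => w; rewrite mul1r. Qed.

Lemma sqint_integrable (X : sqint) : P.-integrable setT (EFin \o X).
Proof.
have := sqint_mul_integrable X sqint1; rewrite sqint1E.
by congr (_.-integrable _ _); apply/funext => w /=; rewrite mulr1.
Qed.

Lemma inner_ind X B : measurable B ->
  (inner X (ind B))%:E = (\int[P]_(w in B) (X w)%:E)%E.
Proof.
move=> mB; rewrite innerE /Rintegral fineK; last first.
  by apply: integrable_fin_num => //; exact: sqint_mul_integrable.
rewrite indE// [RHS]integral_mkcond; apply: eq_integral => w _.
by rewrite epatch_indic EFinM.
Qed.

Lemma nsq_sqint1 : nsq inner sqint1 = 1.
Proof.
apply: EFin_inj; rewrite nsqE sqint1E.
under eq_integral do rewrite expr1n.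
by rewrite integral_cst// mul1e; exact: probability_setT.
Qed.

End square_integrable.
#[global] Hint Resolve sqint_measurable : core.

(** * Completeness of L_2 *)

Section completeness.
Context {R : realType} {d : measure_display} {Omega : measurableType d}.
Variable P : probability Omega R.
Local Notation sqint := (sqint P).
Implicit Types (G : set (set Omega)) (X Y : Omega -> R).

Lemma sigma_algebra_setC G B : sigma_algebra setT G -> G B -> G (~` B).
Proof. by move=> [_ GC _] /GC; rewrite setTD. Qed.

Lemma sigma_algebra_setU G B C : sigma_algebra setT G -> G B -> G C -> G (B `|` C).
Proof.
move=> sG GB GC; have <- := sigma_algebra_id sG.
by apply: (@measurableU _ (g_sigma_algebraType G)); exact: sub_sigma_algebra.
Qed.

Lemma sigma_algebra_setI G B C : sigma_algebra setT G -> G B -> G C -> G (B `&` C).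
Proof.
move=> sG GB GC; have <- := sigma_algebra_id sG.
by apply: (@measurableI _ (g_sigma_algebraType G)); exact: sub_sigma_algebra.
Qed.

Lemma measurable_wrtP G X : sigma_algebra setT G ->
  measurable_wrt G X <-> forall U, measurable U -> G (X @^-1` U).
Proof.
move=> sG; have {2}<- := sigma_algebra_id sG.
split=> [mX U mU|GX _ U mU].
  by rewrite -[_ @^-1` _]setTI; exact: (mX measurableT).
by rewrite setTI; exact: GX.
Qed.

Lemma measurable_wrt_sub G1 G2 X :
  G1 `<=` G2 -> measurable_wrt G1 X -> measurable_wrt G2 X.
Proof.
move=> G12 mX _ U mU; have := mX measurableT U mU.
exact: sub_smallest2r.
Qed.

Lemma measurable_wrt_measurable G X :
  G `<=` measurable -> measurable_wrt G X -> measurable_fun setT X.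
Proof.
move=> Gm mX _ U mU; have := mX measurableT U mU; apply: smallest_sub => //.
exact: sigma_algebra_measurable.
Qed.

Lemma measurable_wrtD G X Y : measurable_wrt G X -> measurable_wrt G Y ->
  measurable_wrt G (fun w => X w + Y w).
Proof. by move=> mX mY; exact: (@measurable_funD _ (g_sigma_algebraType G)). Qed.

Lemma measurable_wrtM G X Y : measurable_wrt G X -> measurable_wrt G Y ->
  measurable_wrt G (fun w => X w * Y w).
Proof. by move=> mX mY; exact: (@measurable_funM _ (g_sigma_algebraType G)). Qed.

Lemma measurable_wrt_cst G r : measurable_wrt G (cst r : Omega -> R).
Proof. exact: (@measurable_cst _ _ (g_sigma_algebraType G)). Qed.

Lemma measurable_wrt_indic G B : G B -> measurable_wrt G (\1_B : Omega -> R).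
Proof.
move=> GB; apply: (@measurable_indic _ (g_sigma_algebraType G)).
exact: sub_sigma_algebra.
Qed.

(** Preimages under [X] and [Y] differ by null sets, and [G] contains these. *)
Lemma measurable_wrt_ae G X Y : sub_sigma_field P G ->
  measurable_wrt G X -> measurable_fun setT Y -> X = Y %[ae P] ->
  measurable_wrt G Y.
Proof.
move=> [sG Gm nG] mX mY XY.
apply/(measurable_wrtP _ sG) => U mU.
have GX := (measurable_wrtP X sG).1 mX U mU.
have mYU : measurable (Y @^-1` U) by rewrite -[_ @^-1` _]setTI; exact: mY.
have mXU : measurable (X @^-1` U) by exact: Gm.
have null D : measurable D -> D `<=` [set w | X w <> Y w] -> G D.
  move=> mD DXY; apply: nG; split=> //.
  case: XY => N [mN N0 XYN]; apply: (subset_measure0 _ _ _ N0) => //.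
  by move=> w /DXY nXY; apply: XYN => /= /(_ I).
rewrite (_ : Y @^-1` U = ((X @^-1` U) `&` ~` ((X @^-1` U) `\` (Y @^-1` U))) `|`
                         ((Y @^-1` U) `\` (X @^-1` U))); last first.
  apply/seteqP; split=> w /=; last by case=> [[? /not_andP[]// /contrapT]|[]].
  move=> YU; have [XU|XU] := pselect (U (X w)); [left|right]; split => //.
  by case.
apply: sigma_algebra_setU => //.
  apply: sigma_algebra_setI => //; apply: sigma_algebra_setC => //.
  apply: null; first exact: measurableD.
  by move=> w /= [XU YU] XYw; apply: YU; rewrite -XYw.
apply: null; first exact: measurableD.
by move=> w /= [YU XU] XYw; apply: XU; rewrite XYw.
Qed.

Lemma measurable_wrt_sqint G (X Y : sqint) : sub_sigma_field P G ->
  measurable_wrt G X -> nsq (@inner _ _ _ P) (X - Y) = 0 -> measurable_wrt G Y.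
Proof. by move=> GP mX /nsqB0_ae; apply: measurable_wrt_ae. Qed.

(** Cauchy-Schwarz against the constant 1, which has norm 1. It makes fast L_2 increments summable
    in L_1. *)
Lemma integral_normr_le (X : sqint) :
  (\int[P]_w `|X w|%:E <= (Num.sqrt (nsq (@inner _ _ _ P) X))%:E)%E.
Proof.
have LA : (fun w => `|X w|) \in Lfun P 2%:E.
  apply: Lfun2P; first exact: measurableT_comp.
  under eq_integral do rewrite real_normK ?num_real//.
  by rewrite -nsqE ltry.
have AE := mk_sqintE LA; set A := mk_sqint P _ in AE.
have sA : nsq (@inner _ _ _ P) A = nsq (@inner _ _ _ P) X.
  apply: EFin_inj; rewrite !nsqE AE; apply: eq_integral => w _.
  by rewrite real_normK ?num_real.
have -> : (\int[P]_w `|X w|%:E)%E = (inner A (sqint1 P))%:E.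
  rewrite innerE /Rintegral fineK; last first.
    by apply: integrable_fin_num => //; exact: sqint_mul_integrable.
  by apply: eq_integral => w _; rewrite AE sqint1E/= mulr1.
rewrite lee_fin -sA (le_trans (ler_norm _))// -sqrtr_sqr ler_wsqrtr//.
have := cauchy_schwarz (inner_semi_inner P) A (sqint1 P).
by rewrite nsq_sqint1 mulr1.
Qed.

Lemma limn_einf_le (u : (\bar R)^nat) (l : \bar R) :
  (\forall n \near \oo, (u n <= l)%E) -> (limn_einf u <= l)%E.
Proof.
move=> [N _ ul]; rewrite limn_einf_lim; apply: lime_le; first exact: is_cvg_einfs.
apply: nearW => n; apply: ge_ereal_inf; exists (u (maxn n N)).
  by exists (maxn n N) => //=; exact: leq_maxl.
by apply: ul => /=; exact: leq_maxr.
Qed.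

Lemma nneseries_cvg (x : R^nat) :
  (\sum_(0 <= k <oo) `|x k.+1 - x k|%:E < +oo)%E -> cvgn x.
Proof.
move=> fin.
suff : cvgn (series (telescope x)).
  move=> xc; have -> : x = cst (x 0%N) + series (telescope x).
    by apply/funext => n; rewrite {1}(eq_sum_telescope x n).
  by apply: is_cvgD => //; exact: is_cvg_cst.
by apply: normed_cvg; apply: (@nnseries_is_cvg R (fun k => `|x k.+1 - x k|)).
Qed.

(** Riesz-Fischer inside [G]: a fast subsequence converges almost everywhere, and Fatou turns the
    Cauchy bounds into bounds on the distance to the limit. *)
Lemma sqint_complete G : sub_sigma_field P G ->
  nsq_closed (@inner _ _ _ P) [set X : sqint | measurable_wrt G X].
Proof.
move=> [sG Gm nG] x mx xc.
have e4 (k : nat) : 0 < (4^-1 : R) ^+ k by rewrite exprn_gt0 ?invr_gt0.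
have /choice[f fP] := fun k => xc _ (e4 k).
(* The sum passes every threshold [f j] with [j <= k], and the summand [k] keeps [s k] at least [k],
   as needed when Fatou is applied. *)
pose s k := (k + \sum_(j < k.+1) f j)%N.
have sf k n : (k <= n)%N -> (f k <= s n)%N.
  move=> kn; have kn' : (k < n.+1)%N by [].
  by rewrite /s (bigD1 (Ordinal kn'))//= addnCA leq_addr.
pose y k := x (s k).
have yP k : nsq (@inner _ _ _ P) (y k.+1 - y k) < 4^-1 ^+ k by apply: fP; exact: sf.
pose g k w := `|y k.+1 w - y k w|%:E : \bar R.
have mg k : measurable_fun setT (g k).
  apply/measurable_EFinP; apply: measurableT_comp => //.
  exact: measurable_funB.
have gfin : {ae P, forall w, (\sum_(0 <= k <oo) g k w < +oo)%E}.
  have sge0 w : (0 <= \sum_(0 <= k <oo) g k w)%E.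
    by apply: nneseries_ge0 => k _ _; rewrite lee_fin.
  have fin : (\int[P]_w (\sum_(0 <= k <oo) g k w) < +oo)%E.
    rewrite integral_nneseries//; last by move=> n w _; rewrite lee_fin.
    have half := cvg_lim (@ereal_hausdorff R) (@cvg_geometric_eseries_half R 2 0).
    apply: (@le_lt_trans _ _ (\sum_(0 <= k <oo) (2 / (2 ^ (k + 1))%:R)%:E)%E).
      apply: lee_nneseries => [k _ _|k _]; first by apply: integral_ge0 => w _;
        rewrite lee_fin.
      apply: (le_trans (integral_normr_le (y k.+1 - y k))); rewrite lee_fin.
      rewrite addn1 expnS natrM invfM mulrA divff// mul1r natrX.
      rewrite -[leRHS]ger0_norm ?invr_ge0 ?exprn_ge0// -sqrtr_sqr ler_wsqrtr//
        (le_trans (ltW (yP k)))//.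
      by rewrite -exprVn -exprM mulnC exprM (_ : (2^-1) ^+ 2 = 4^-1 :> R)//; field.
    by rewrite half expr0 divr1 ltry.
  have /integrable_ae : P.-integrable setT (fun w => \sum_(0 <= k <oo) g k w)%E.
    apply/integrableP; split.
      apply: ge0_emeasurable_sum => // k w _ _; by rewrite lee_fin.
    by under eq_integral do rewrite gee0_abs//.
  move=> /(_ measurableT); apply: filterS => w /(_ I).
  by rewrite ge0_fin_numE.
(* The upper limit is defined everywhere and [G]-measurable, while an almost sure limit is not yet a
   function. *)
pose Yf w := fine (limn_esup (fun k => (y k w)%:E)).
have Ycvg : {ae P, forall w, y k w @[k --> \oo] --> Yf w}.
  apply: filterS gfin => w /nneseries_cvg yw.
  have yl : (y k w)%:E @[k --> \oo] --> (limn (fun k => y k w))%:E.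
    by apply: cvg_EFin; [exact: nearW|exact: yw].
  by rewrite /Yf (cvg_limn_einf_sup yl).2; exact: yw.
have mYf : measurable_wrt G Yf.
  rewrite /Yf.
  apply: (@measurableT_comp _ _ _ (g_sigma_algebraType G) _ _ fine) => //.
  apply: (@measurable_fun_limn_esup _ (g_sigma_algebraType G)) => n.
  by apply/measurable_EFinP; exact: mx.
have mYfT := measurable_wrt_measurable Gm mYf.
have bound e : 0 < e -> exists N, forall n, (N <= n)%N ->
    (\int[P]_w ((x n w - Yf w) ^+ 2)%:E <= e%:E)%E.
  move=> e0; have [N NP] := xc _ e0; exists N => n Nn.
  pose h k w := ((x n w - y k w) ^+ 2)%:E.
  have mh k : measurable_fun setT (h k).
    apply/measurable_EFinP; apply: measurable_funX; exact: measurable_funB.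
  have h0 k w : setT w -> (0 <= h k w)%E by rewrite lee_fin sqr_ge0.
  have := fatou P measurableT mh h0.
  rewrite (_ : (\int[P]_w _ = \int[P]_w ((x n w - Yf w) ^+ 2)%:E)%E); last first.
    apply: ae_eq_integral => //.
    - rewrite (_ : (fun w => _) = (fun w => - limn_esup (fun k => - h k w))%E).
        apply: measurableT_comp => //; apply: measurable_fun_limn_esup => k.
        exact: measurableT_comp.
      apply/funext => w.
      by rewrite -[RHS]/(- limn_esup (-%E \o (h^~ w)))%E limn_esupN oppeK.
    - by apply/measurable_EFinP; apply: measurable_funX; exact: measurable_funB.
    - apply: filterS Ycvg => w yw _; apply: (cvg_limn_einf_sup _).1.
      apply: cvg_EFin; first exact: nearW.
      have xy : x n w - y k w @[k --> \oo] --> x n w - Yf w.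
        by apply: cvgB => //; exact: cvg_cst.
      exact: (cvgM xy xy).
  move=> /le_trans; apply; apply: limn_einf_le.
  exists N => // k Nk /=; rewrite -(nsqE (x n - y k)) lee_fin ltW// NP//.
  by rewrite (leq_trans Nk)// leq_addr.
have [N NP] := bound 1 ltr01.
have LD : (fun w => x N w - Yf w) \in Lfun P 2%:E.
  apply: Lfun2P; first exact: measurable_funB.
  by rewrite (le_lt_trans (NP N (leqnn N)))// ltry.
(* Square integrability is known for the difference [x N - Yf] only, by the bound with [e = 1]; it
   is carried over to [Yf] from there. *)
pose Y := x N - mk_sqint P (fun w => x N w - Yf w).
have YE : Y = Yf :> (_ -> _).
  apply/funext => w; rewrite -[LHS]/(x N w - mk_sqint P (fun w => x N w - Yf w) w).
  by rewrite mk_sqintE// opprB addrC subrK.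
exists Y; first by suff : measurable_wrt G Y by []; rewrite YE.
apply/cvgrPdist_le => e e0; have [K KP] := bound e e0.
exists K => // n Kn /=; rewrite sub0r normrN ger0_norm ?nsq_ge0//; last first.
  exact: inner_semi_inner.
rewrite -lee_fin nsqE (le_trans _ (KP n Kn))//.
rewrite le_eqVlt; apply/orP; left; apply/eqP; apply: eq_integral => w _.
by rewrite -[LHS]/(((x n w - Y w) ^+ 2)%:E) YE.
Qed.

End completeness.

(** * Conditional expectation *)

HB.lock Definition CE {R : realType} {d : measure_display}
    {Omega : measurableType d} (P : probability Omega R) (G : set (set Omega))
    (X : sqint P) : sqint P :=
  mk_sqint P (cond_exp P G X).

Arguments CE {R d Omega P} G X.

Section conditional_expectation.
Context {R : realType} {d : measure_display} {Omega : measurableType d}.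
Variable P : probability Omega R.
Local Notation sqint := (sqint P).
Local Notation inner := (@inner _ _ _ P).
Local Notation nsq := (nsq inner).
Local Notation ind := (ind P).
Local Notation ipP := (inner_semi_inner P).
Implicit Types (G K : set (set Omega)) (B C : set Omega) (X Y Z : sqint).

Lemma is_cond_exp_ae G (X : sqint) (Y1 Y2 : Omega -> R) : sub_sigma_field P G ->
  is_cond_exp P G X Y1 -> is_cond_exp P G X Y2 -> Y1 = Y2 %[ae P].
Proof.
move=> [sG Gm nG].
have half (Z1 Z2 : Omega -> R) :
    is_cond_exp P G X Z1 -> is_cond_exp P G X Z2 ->
    {ae P, forall w, Z1 w <= Z2 w}.
  move=> [m1 i1 I1] [m2 i2 I2].
  pose D := [set w | Z2 w < Z1 w].
  have GD : G D.
    have m12 : measurable_wrt G (fun w => Z1 w + -1 * Z2 w).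
      by apply: measurable_wrtD => //; apply: measurable_wrtM => //;
        exact: measurable_wrt_cst.
    have := (measurable_wrtP _ sG).1 m12 `]0%R, +oo[%classic (measurable_itv _).
    congr G; apply/seteqP; split => w /=; rewrite in_itv/= andbT mulN1r subr_gt0//.
  have mD := Gm _ GD.
  have j1 : P.-integrable D (EFin \o Z1) by exact: (integrableS measurableT).
  have j2 : P.-integrable D (EFin \o Z2) by exact: (integrableS measurableT).
  have : (\int[P]_(w in D) ((Z1 w)%:E - (Z2 w)%:E) = 0)%E.
    rewrite integralB_EFin// I1// I2// subee// -I2//; exact: integrable_fin_num.
  have mB : measurable_fun D (fun w => (Z1 w)%:E - (Z2 w)%:E)%E.
    by apply: emeasurable_funB; [case/integrableP: j1|case/integrableP: j2].
  have -> : (\int[P]_(w in D) ((Z1 w)%:E - (Z2 w)%:E) =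
             \int[P]_(w in D) `|((Z1 w)%:E - (Z2 w)%:E)|)%E.
    apply: eq_integral => w; rewrite inE /D/= => Dw.
    by rewrite ger0_norm ?subr_ge0// ltW.
  move=> /(ae_eq_integral_abs P mD mB); apply: filterS => w Dw.
  rewrite leNgt; apply/negP => Dw'; have := Dw Dw' => /= -[] /eqP.
  by rewrite subr_eq0 => /eqP Z12; move: Dw'; rewrite Z12 ltxx.
move=> c1 c2; near=> w => _; apply/eqP; rewrite eq_le; apply/andP; split; near: w.
  exact: half.
exact: half.
Unshelve. all: by end_near. Qed.

Lemma measurable_wrt_linear G a X Y : measurable_wrt G X -> measurable_wrt G Y ->
  measurable_wrt G (a *: X + Y).
Proof.
move=> mX mY; apply: measurable_wrtD => //; apply: measurable_wrtM => //.
exact: measurable_wrt_cst.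
Qed.

Lemma restr_sqint1 B : restr B (sqint1 P) = ind B. Proof. by []. Qed.

Lemma measurable_wrt_ind G B : measurable B -> G B -> measurable_wrt G (ind B).
Proof. by move=> mB GB; rewrite indE//; exact: measurable_wrt_indic. Qed.

Lemma cond_exp_projection G X : sub_sigma_field P G ->
  exists Y : sqint, measurable_wrt G Y /\
    forall Z, measurable_wrt G Z -> inner (X - Y) Z = 0.
Proof.
move=> GP; have := orthogonal_projection ipP X _ _ (sqint_complete GP).
move=> [|a Y Z mY mZ|Y mY YP]; last by exists Y.
  exact: measurable_wrt_cst.
exact: measurable_wrt_linear.
Qed.

Lemma is_cond_expP G X Y : sub_sigma_field P G -> measurable_wrt G Y ->
  (forall B, G B -> inner Y (ind B) = inner X (ind B)) -> is_cond_exp P G X Y.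
Proof.
move=> [_ Gm _] mY YX; split => // [|B GB]; first exact: sqint_integrable.
by rewrite -!inner_ind ?YX//; exact: Gm.
Qed.

Local Notation CE := (@CE _ _ _ P).

(** [cond_exp] is a choice, meaningful once some version exists. The orthogonal projection is a
    version, and uniqueness makes the chosen one agree with it almost surely. *)
Lemma cond_exp_spec G X : sub_sigma_field P G ->
  is_cond_exp P G X (cond_exp P G X) /\
  exists2 Y : sqint, measurable_wrt G Y /\
     (forall Z, measurable_wrt G Z -> inner (X - Y) Z = 0) &
     cond_exp P G X = Y %[ae P].
Proof.
move=> GP; have [Y [mY YX]] := cond_exp_projection X GP.
have cY : is_cond_exp P G X Y.
  apply: is_cond_expP => // B GB; have [_ Gm _] := GP.
  apply/eqP; rewrite eq_sym -subr_eq0 -(ipBl ipP) YX//.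
  by apply: measurable_wrt_ind => //; exact: Gm.
have cX : is_cond_exp P G X (cond_exp P G X).
  exact: (xgetI (P := [set f | is_cond_exp P G X f]) (cst 0) cY).
by split=> //; exists Y => //; exact: is_cond_exp_ae cX cY.
Qed.

Lemma CEE G X : sub_sigma_field P G -> CE G X = cond_exp P G X :> (_ -> _).
Proof.
move=> GP; have [[mc ic _] [Y _ cY]] := cond_exp_spec X GP.
have [_ Gm _] := GP; have mc' := measurable_wrt_measurable Gm mc.
rewrite CE.unlock; apply: mk_sqintE; apply: Lfun2P => //.
rewrite (_ : (\int[P]_w _)%E = (nsq Y)%:E) ?ltry// nsqE.
apply: ae_eq_integral => //.
- by apply/measurable_EFinP; exact: measurable_funX.
- by apply/measurable_EFinP; exact: measurable_funX.
- by apply: filterS cY => w cY _ /=; rewrite cY.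
Qed.

Lemma measurable_wrt_CE G X : sub_sigma_field P G -> measurable_wrt G (CE G X).
Proof. by move=> GP; rewrite CEE//; have [[]] := cond_exp_spec X GP. Qed.

Lemma CE_inner G X Z : sub_sigma_field P G -> measurable_wrt G Z ->
  inner (CE G X) Z = inner X Z.
Proof.
move=> GP mZ; have [_ [Y [mY YX] cY]] := cond_exp_spec X GP.
rewrite (nsqB0_ip ipP (y := Y)); last by apply/nsqB0_ae; rewrite CEE.
by apply/eqP; rewrite eq_sym -subr_eq0 -(ipBl ipP) YX.
Qed.

Lemma CE_sym G X Y : sub_sigma_field P G -> inner (CE G X) Y = inner X (CE G Y).
Proof.
move=> GP; rewrite -(CE_inner _ GP (measurable_wrt_CE Y GP)).
rewrite [RHS](ipC ipP) (CE_inner _ GP (measurable_wrt_CE X GP)).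
exact: (ipC ipP).
Qed.

Lemma CE_unique G X Y : sub_sigma_field P G -> measurable_wrt G Y ->
  (forall B, G B -> inner Y (ind B) = inner X (ind B)) -> nsq (Y - CE G X) = 0.
Proof.
move=> GP mY YX; apply/nsqB0_ae; rewrite CEE//.
apply: (@is_cond_exp_ae G X) => //; first exact: is_cond_expP.
by have [] := cond_exp_spec X GP.
Qed.

Lemma CE_id G X : sub_sigma_field P G -> measurable_wrt G X -> nsq (X - CE G X) = 0.
Proof. by move=> GP mX; apply: CE_unique. Qed.

Lemma inner_ind_bigcup Z (B : nat -> set Omega) :
  (forall n, measurable (B n)) -> trivIset setT B ->
  (forall n, inner Z (ind (B n)) = 0) -> inner Z (ind (\bigcup_n B n)) = 0.
Proof.
move=> mB tB B0; apply: EFin_inj; rewrite inner_ind; last exact: bigcup_measurable.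
rewrite integral_bigcup//; last first.
  apply: (integrableS measurableT) => //; first exact: bigcup_measurable.
  exact: sqint_integrable.
by apply: eseries0 => n _ _; rewrite -inner_ind// B0.
Qed.

Lemma inner_ind_setC Z B : measurable B -> inner Z (sqint1 P) = 0 ->
  inner Z (ind B) = 0 -> inner Z (ind (~` B)) = 0.
Proof.
move=> mB Z1 ZB; have -> : ind (~` B) = sqint1 P - ind B.
  apply/LfuneqP => w; rewrite indE ?sqint1E//; last exact: measurableC.
  rewrite -[RHS]/(sqint1 P w - ind B w) indE// sqint1E !indicE in_setC.
  by case: (w \in B); rewrite /= ?subrr ?subr0.
by rewrite (ipBr ipP) Z1 ZB subrr.
Qed.

(** Dynkin's argument: once [Z] has mean 0, the events over which it integrates to 0 form a
    lambda-system. *)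
Lemma inner_ind_pi_lambda Z (C : set (set Omega)) :
  setI_closed C -> C `<=` measurable -> inner Z (sqint1 P) = 0 ->
  (forall B, C B -> inner Z (ind B) = 0) ->
  forall B, <<s C >> B -> inner Z (ind B) = 0.
Proof.
move=> IC mC Z1 ZC B; rewrite -setI_closed_g_dynkin_g_sigma_algebra// => CB.
suff [] : [set B | measurable B /\ inner Z (ind B) = 0] B by [].
apply: CB; split; last by move=> D CD; split; [exact: mC|exact: ZC].
split.
- split => //; rewrite -Z1; congr inner; apply/LfuneqP => w.
  by rewrite indE// sqint1E indicT.
- move=> D [mD D0]; split; first exact: measurableC.
  exact: inner_ind_setC.
- move=> D tD DP; split; first by apply: bigcup_measurable => n _; case: (DP n).
  by apply: inner_ind_bigcup => // n; case: (DP n).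
Qed.

End conditional_expectation.

(** * Independence *)

Section independence.
Context {R : realType} {d : measure_display} {Omega : measurableType d}.
Variable P : probability Omega R.
Local Notation sqint := (sqint P).
Local Notation inner := (@inner _ _ _ P).
Local Notation nsq := (nsq inner).
Local Notation ind := (ind P).
Local Notation ipP := (inner_semi_inner P).
Local Notation one := (sqint1 P).
Local Notation gen := (gen_sigma_field P).
Implicit Types (G K : set (set Omega)) (B C : set Omega) (X Y Z : sqint).

Lemma sub_gen G : G `<=` gen G.
Proof. by move=> B GB; apply: sub_sigma_algebra; left. Qed.

Lemma gen_sub_sigma_field G : G `<=` measurable -> sub_sigma_field P (gen G).
Proof.
move=> Gm; split.
- exact: smallest_sigma_algebra.
- apply: smallest_sub; first exact: sigma_algebra_measurable.
  by move=> B [/Gm//|[]].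
- by move=> B NB; apply: sub_sigma_algebra; right.
Qed.

Lemma gen_min G K : sub_sigma_field P K -> G `<=` K -> gen G `<=` K.
Proof.
move=> [sK Km nK] GK; apply: smallest_sub => // B [/GK//|]; exact: nK.
Qed.

Lemma gen_mono G K : G `<=` K -> gen G `<=` gen K.
Proof. by move=> GK; apply: sub_smallest2r => //; exact: setSU. Qed.

Lemma sub_sigma_fieldT G : sub_sigma_field P G -> G setT.
Proof. by move=> [sG _ _]; rewrite -setC0; apply: sigma_algebra_setC => //;
  case: sG. Qed.

Lemma sigma_field_of_sub_sigma_field (H : set (Omega -> R)) :
  (forall f, H f -> measurable_fun setT f) -> sub_sigma_field P (sigma_field_of P H).
Proof.
by move=> mH; apply: gen_sub_sigma_field => B [f /mH mf] [U mU <-]; exact: mf.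
Qed.

Lemma sigma_field_of_min (H : set (Omega -> R)) G : sub_sigma_field P G ->
  (forall f, H f -> measurable_wrt G f) -> sigma_field_of P H `<=` G.
Proof.
move=> GP HG; apply: gen_min => // B [f /HG mf] [U mU <-].
by rewrite setTI; have [sG _ _] := GP; exact: (measurable_wrtP f sG).1 mf U mU.
Qed.

Lemma measurable_sigma_field_of (H : set (Omega -> R)) f :
  H f -> measurable_wrt (sigma_field_of P H) f.
Proof.
move=> Hf; have sG : sigma_algebra setT (sigma_field_of P H).
  exact: smallest_sigma_algebra.
apply/(measurable_wrtP f sG) => U mU; apply: sub_gen.
by exists f => //; exists U => //; rewrite setTI.
Qed.

Lemma ind_setI B C : measurable B -> measurable C ->
  ind (B `&` C) = restr B (ind C).
Proof.
move=> mB mC; apply/LfuneqP => w; rewrite restrE// !indE//; last exact: measurableI.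
by rewrite indicI/= mulrC.
Qed.

Lemma indT : ind setT = one.
Proof. by apply/LfuneqP => w; rewrite indE// sqint1E indicT. Qed.

(** Rectangles form a pi-system generating the joint field; the null sets added by [gen] already lie
    in [G], so they are rectangles too. *)
Lemma inner_ind_rect G K X Y : sub_sigma_field P G -> sub_sigma_field P K ->
  (forall B C, G B -> K C -> inner X (ind (B `&` C)) = inner Y (ind (B `&` C))) ->
  forall B, gen (G `|` K) B -> inner X (ind B) = inner Y (ind B).
Proof.
move=> GP KP XY B genB; have [sG Gm nG] := GP; have [sK Km nK] := KP.
pose rect := [set D | exists B C, [/\ G B, K C & D = B `&` C]].
apply/eqP; rewrite -subr_eq0 -(ipBl ipP); apply/eqP.
apply: (@inner_ind_pi_lambda _ _ _ _ _ rect).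
- move=> _ _ [B1 [C1 [GB1 KC1 ->]]] [B2 [C2 [GB2 KC2 ->]]].
  exists (B1 `&` B2), (C1 `&` C2); rewrite setIACA; split=> //.
    exact: sigma_algebra_setI.
  exact: sigma_algebra_setI.
- by move=> _ [B1 [C1 [GB1 KC1 ->]]]; apply: measurableI; [exact: Gm|exact: Km].
- rewrite (ipBl ipP) -indT -(setTI setT) XY ?subrr//; exact: sub_sigma_fieldT.
- by move=> _ [B1 [C1 [GB1 KC1 ->]]]; rewrite (ipBl ipP) XY// subrr.
- move: B genB; apply: smallest_sub; first exact: smallest_sigma_algebra.
  move=> B [[GB|KB]|/nG GB]; apply: sub_sigma_algebra.
  + by exists B, setT; rewrite setIT; split=> //; exact: sub_sigma_fieldT.
  + by exists setT, B; rewrite setTI; split=> //; exact: sub_sigma_fieldT.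
  + by exists B, setT; rewrite setIT; split=> //; exact: sub_sigma_fieldT.
Qed.

Lemma inner_ind1 B : measurable B -> (inner one (ind B))%:E = P B.
Proof.
move=> mB; rewrite inner_ind// sqint1E.
by rewrite -[LHS]/(\int[P]_(w in B) cst 1%:E w)%E integral_cst// mul1e.
Qed.

(** Independence speaks of events only. It says that the centred indicator of [B] projects to 0 on
    [G], and this holds against every [G]-measurable [Z] without approximation by simple
    functions. *)
Lemma indep_inner G K Z B : sub_sigma_field P G -> sub_sigma_field P K ->
  independent_fields P G K -> measurable_wrt G Z -> K B ->
  inner Z (ind B) = inner Z one * inner one (ind B).
Proof.
move=> GP KP GK mZ KB; have [_ Gm _] := GP; have [_ Km _] := KP.
have mB := Km _ KB.
pose W := ind B - inner one (ind B) *: one.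
have W0 : nsq (0 - CE G W) = 0.
  apply: CE_unique => //; first exact: measurable_wrt_cst.
  move=> C GC; have mC := Gm _ GC.
  rewrite (ip0l ipP) (ipBl ipP) (ipZl ipP); apply/esym/eqP; rewrite subr_eq0;
    apply/eqP.
  apply: EFin_inj; rewrite EFinM !inner_ind1// muleC -GK// -(inner_ind1
    (measurableI _ _ mC mB)).
  by rewrite ind_setI// -inner_restr// restr_sqint1; congr EFin; exact: (ipC ipP).
have : inner Z W = 0.
  by rewrite (ipC ipP) -(CE_inner W GP mZ) -(nsqB0_ip ipP _ W0) (ip0l ipP).
rewrite (ipBr ipP) (ipZr ipP) => /eqP; rewrite subr_eq0 => /eqP ->.
by rewrite mulrC.
Qed.

Lemma measurable_wrt_restr G B X : measurable B -> G B ->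
  measurable_wrt G X -> measurable_wrt G (restr B X).
Proof.
move=> mB GB mX; rewrite restrE//.
by apply: measurable_wrtM => //; exact: measurable_wrt_indic.
Qed.

(** Adjoining independent information changes nothing: on a rectangle the probability of the event
    from [K] factors out of both sides, leaving the defining property of [CE G1 Y]. *)
Lemma CE_indep G1 G2 K Y : sub_sigma_field P G1 -> sub_sigma_field P G2 ->
  sub_sigma_field P K -> G1 `<=` G2 -> independent_fields P G2 K ->
  measurable_wrt G2 Y ->
  nsq (CE G1 Y - CE (gen (G1 `|` K)) Y) = 0.
Proof.
move=> G1P G2P KP G12 GK mY; have [_ G1m _] := G1P; have [_ Km _] := KP.
apply: CE_unique.
- by apply: gen_sub_sigma_field => B [/G1m|/Km].
- apply: measurable_wrt_sub (measurable_wrt_CE Y G1P).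
  by apply: subset_trans (@sub_gen _); exact: subsetUl.
- apply: inner_ind_rect => // B C G1B KC.
  have mB := G1m _ G1B; have mC := Km _ KC.
  rewrite ind_setI// -[LHS]inner_restr// -[RHS]inner_restr//.
  have m1 : measurable_wrt G2 (restr B (CE G1 Y)).
    apply: measurable_wrt_restr => //; first exact: G12.
    exact: measurable_wrt_sub (measurable_wrt_CE Y G1P).
  have m2 : measurable_wrt G2 (restr B Y).
    by apply: measurable_wrt_restr => //; exact: G12.
  rewrite (indep_inner G2P KP GK m1 KC) (indep_inner G2P KP GK m2 KC).
  congr (_ * _); rewrite !inner_restr// restr_sqint1.
  by rewrite CE_inner//; exact: measurable_wrt_ind.
Qed.

End independence.

(** * Sparse and additive elements of a noise *)

Section more_conditional_expectation.
Context {R : realType} {d : measure_display} {Omega : measurableType d}.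
Variable P : probability Omega R.
Local Notation sqint := (sqint P).
Local Notation inner := (@inner _ _ _ P).
Local Notation nsq := (nsq inner).
Local Notation ind := (ind P).
Local Notation ipP := (inner_semi_inner P).
Local Notation one := (sqint1 P).
Local Notation gen := (gen_sigma_field P).
Implicit Types (G K : set (set Omega)) (B C : set Omega) (X Y Z : sqint).


Lemma CE_null G X Y : sub_sigma_field P G -> nsq (X - Y) = 0 ->
  nsq (CE G X - CE G Y) = 0.
Proof.
move=> GP XY; apply: (ip_eq_nsqB0 ipP) => Z.
by rewrite !CE_sym// (nsqB0_ip ipP _ XY).
Qed.

Lemma CE_tower G K X : sub_sigma_field P G -> sub_sigma_field P K -> G `<=` K ->
  nsq (CE G (CE K X) - CE G X) = 0.
Proof.
move=> GP KP GK; have [_ Gm _] := GP.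
apply: CE_unique => //; first exact: measurable_wrt_CE.
move=> B GB; have mB : measurable_wrt G (ind B).
  by apply: measurable_wrt_ind => //; exact: Gm.
rewrite CE_inner// CE_inner//; exact: measurable_wrt_sub mB.
Qed.

Lemma CE_restr G B X : sub_sigma_field P G -> G B ->
  nsq (restr B (CE G X) - CE G (restr B X)) = 0.
Proof.
move=> GP GB; have [_ Gm _] := GP; have mB := Gm _ GB.
apply: CE_unique => //.
  by apply: measurable_wrt_restr => //; exact: measurable_wrt_CE.
move=> C GC; rewrite !inner_restr// CE_inner//.
by apply: measurable_wrt_restr => //; apply: measurable_wrt_ind => //; exact: Gm.
Qed.

Lemma sub_sigma_fieldI G K : sub_sigma_field P G -> sub_sigma_field P K ->
  sub_sigma_field P (G `&` K).
Proof.
move=> [[G0 GC GU] Gm nG] [[K0 KC KU] _ nK]; split.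
- split=> // [B [GB KB]|B GKB]; first by split; [exact: GC|exact: KC].
  by split; [apply: GU|apply: KU] => n; case: (GKB n).
- by move=> B [/Gm].
- by move=> B NB; split; [exact: nG|exact: nK].
Qed.

(** An event independent of itself has probability 0 or 1, so it or its complement is null. *)
Lemma self_independent_sub G K : sub_sigma_field P G -> sub_sigma_field P K ->
  independent_fields P G G -> G `<=` K.
Proof.
move=> [_ Gm _] [sK Km nK] GG B GB; have mB := Gm _ GB.
have := GG _ _ GB GB; rewrite setIid -(inner_ind1 P mB) -EFinM => -[] h.
have /eqP : inner one (ind B) * (1 - inner one (ind B)) = 0 by lra.
rewrite mulf_eq0 subr_eq0 => /orP[] /eqP e.
  by apply: nK; split => //; rewrite -(inner_ind1 P mB) e.
rewrite -(setCK B); apply: sigma_algebra_setC => //; apply: nK; split.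
  exact: measurableC.
by rewrite probability_setC// -(inner_ind1 P mB) -e subee.
Qed.

End more_conditional_expectation.

Section noise.
Context {R : realType} {d : measure_display} {Omega : measurableType d}.
Variable P : probability Omega R.
Context {T : Type}.
Variables (A : set (set T)) (F : set T -> set (set Omega)).
Local Notation sqint := (sqint P).
Local Notation inner := (@inner _ _ _ P).
Local Notation nsq := (nsq inner).
Local Notation ind := (ind P).
Local Notation ipP := (inner_semi_inner P).
Local Notation one := (sqint1 P).
Local Notation gen := (gen_sigma_field P).
Implicit Types (a b : set T) (X Y Z : sqint).

Hypothesis algA : set_algebra A.
Hypothesis FP : forall a, A a -> sub_sigma_field P (F a).
Hypothesis FI : forall a b, A a -> A b -> a `&` b = set0 ->
  independent_fields P (F a) (F b) /\ F (a `|` b) = gen (F a `|` F b).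

Local Notation E a := (CE (P := P) (F a)).

Lemma A0 : A set0. Proof. by case: algA. Qed.
Lemma AC a : A a -> A (~` a). Proof. by case: algA => _ _; apply. Qed.
Lemma AU a b : A a -> A b -> A (a `|` b).
Proof. by case: algA => _ AU _; exact: AU. Qed.
Lemma AI a b : A a -> A b -> A (a `&` b).
Proof. by move=> Aa Ab; rewrite -(setCK (a `&` b)) setCI; apply/AC/AU; exact: AC. Qed.
Lemma AD a b : A a -> A b -> A (a `\` b).
Proof. by move=> Aa Ab; rewrite setDE; apply: AI => //; exact: AC. Qed.
Lemma AT : A setT. Proof. by rewrite -setC0; exact/AC/A0. Qed.

Lemma F_mono a b : A a -> A b -> a `<=` b -> F a `<=` F b.
Proof.
move=> Aa Ab ab; have [_] := FI Aa (AD Ab Aa) (setDIK _ _).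
rewrite setDUK// => ->; apply: subset_trans (@sub_gen _ _ _ _ _).
exact: subsetUl.
Qed.

(** [set0] is disjoint from itself, which makes [F set0] independent of itself; thus [E set0] is the
    mean. *)
Lemma F0_sub G : sub_sigma_field P G -> F set0 `<=` G.
Proof.
move=> GP; have [F00 _] := FI A0 A0 (setI0 _).
exact: (self_independent_sub (FP A0) GP F00).
Qed.

(** [F a] is generated by the fields of [a] inside and outside [b]; the outside one is independent
    of [F b], so [CE_indep] discards it. *)
Lemma E_E a b X : A a -> A b -> nsq (E a (E b X) - E (a `&` b) X) = 0.
Proof.
move=> Aa Ab.
have abP := FP (AI Aa Ab); have bP := FP Ab.
have [indep _] := FI Ab (AD Aa Ab) (setDIK _ _).
have dis : (a `&` b) `&` (a `\` b) = set0.
  by apply/seteqP; split => x //= -[[_ bx] []].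
have [_ Fa] := FI (AI Aa Ab) (AD Aa Ab) dis.
have un : (a `&` b) `|` (a `\` b) = a.
  apply/seteqP; split => x /=; first by case=> -[].
  by move=> ax; have [bx|bx] := pselect (b x); [left|right].
rewrite un in Fa.
have ab := F_mono (AI Aa Ab) Ab (@subIsetr _ _ _).
have e1 := CE_indep abP bP (FP (AD Aa Ab)) ab indep (measurable_wrt_CE X bP).
rewrite -Fa in e1; apply: (ip_eq_nsqB0 ipP) => Z.
by rewrite -(nsqB0_ip ipP _ e1) (nsqB0_ip ipP _ (CE_tower _ abP bP ab)).
Qed.

Lemma inner_E_E a b X Y : A a -> A b ->
  inner (E a X) (E b Y) = inner (E (a `&` b) X) Y.
Proof.
move=> Aa Ab; rewrite (CE_sym _ _ (FP Aa)) (ipC ipP) (nsqB0_ip ipP _ (E_E Y Aa Ab)).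
by rewrite (CE_sym _ _ (FP (AI Aa Ab))) (ipC ipP).
Qed.

(* X is sparse on a when (1 - E_(~B)) (1 - E_(~C)) X = 0 for all disjoint B and C
   inside a, i.e. when its spectral sets have at most one point in a.  Tested
   against all Z, the condition is visibly closed in L_2. *)
Definition sparse a X : Prop := forall B C, A B -> A C -> B `&` C = set0 ->
  B `<=` a -> C `<=` a -> forall Z, inner X Z =
    inner X (E (~` B) Z) + inner X (E (~` C) Z) - inner X (E (~` (B `|` C)) Z).

(* B = set0 in this condition forces Z to have mean 0. *)
Definition additive_on a Z : Prop := measurable_wrt (F a) Z /\
  forall B, A B -> forall W, inner Z W = inner Z (E B W) + inner Z (E (~` B) W).

Definition additive_field a : set (set Omega) :=
  sigma_field_of P [set f : Omega -> R | exists2 Z : sqint, additive_on a Z & f = Z].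

Lemma additive_field_sub a G : sub_sigma_field P G ->
  (forall Z, additive_on a Z -> measurable_wrt G Z) -> additive_field a `<=` G.
Proof.
move=> GP aG; apply: (sigma_field_of_min GP) => f [Z addZ fZ].
by rewrite fZ; exact: aG.
Qed.

Lemma additive_field_sub_sigma_field a : sub_sigma_field P (additive_field a).
Proof.
by apply: sigma_field_of_sub_sigma_field => f [Z _ fZ]; rewrite fZ;
  exact: sqint_measurable.
Qed.

Lemma measurable_additive_field a Z : additive_on a Z ->
  measurable_wrt (additive_field a) Z.
Proof. by move=> addZ; apply: measurable_sigma_field_of; exists Z. Qed.

(* For D inside a, E_(~D) (1_B E_a W) = 1_B E_(a \ D) W because B is in F_(~a):
   this moves the defining property of sparse X to E_a (1_B X). *)
Lemma additive_of_sparse a B X : A a -> sparse a X -> F (~` a) B ->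
  additive_on a (E a (restr B X) - E set0 (restr B X)).
Proof.
move=> Aa Xa FB; have ACa := AC Aa; have [_ /(_ _ FB) mB _] := FP ACa.
set Y := restr B X; split.
  rewrite addrC -scaleN1r; apply: measurable_wrt_linear.
    apply: measurable_wrt_sub (measurable_wrt_CE Y (FP A0)).
    by apply: F_mono => //; exact: A0.
  exact: measurable_wrt_CE Y (FP Aa).
move=> D AD_ W; have ACD := AC AD_.
pose B' := D `&` a; pose C' := a `\` D.
have AB : A B' by exact: AI. have AC' : A C' by exact: AD.
have pull b : A b -> b `<=` a ->
    inner X (E (~` b) (restr B (E a W))) = inner (E (a `\` b) Y) W.
  move=> Ab ba; have ACb := AC Ab.
  have FBb : F (~` b) B by apply: (F_mono ACa ACb) => //; exact: subsetC.
  rewrite (ipC ipP) -(nsqB0_ip ipP _ (CE_restr _ (FP ACb) FBb)) inner_restr//.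
  by rewrite (nsqB0_ip ipP _ (E_E _ ACb Aa)) setIC -setDE (ipC ipP)
    -(CE_sym _ _ (FP (AD Aa Ab))).
(* [B'] and [C'] split [a]: removing one of them leaves the other, and removing both leaves
   [set0]. *)
have key : inner (E a Y) W =
    inner (E B' Y) W + inner (E C' Y) W - inner (E set0 Y) W.
  rewrite (CE_sym _ _ (FP Aa)) inner_restr// (Xa B' C')//.
  - rewrite !pull//; last 4 first.
    + exact: AU.
    + by move=> x [[]|[]].
    + by move=> x [].
    + by move=> x [].
    have -> : a `\` B' = C'.
      apply/seteqP; split=> x [ax]; first by move=> nB; split => // Dx; exact: nB.
      by move=> nD; split => // -[].
    have -> : a `\` C' = B'.
      apply/seteqP; split=> x [].
        by move=> ax nC; split => //; apply: contrapT => nD; exact: nC.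
      by move=> Dx ax; split => // -[].
    have -> : a `\` (B' `|` C') = set0.
      apply/seteqP; split=> x // [ax] []; have [Dx|Dx] := pselect (D x).
        by left.
      by right.
    by lra.
  - by apply/seteqP; split=> x //= -[[Dx _] []].
  - by move=> x [].
  - by move=> x [].
have EE c : A c -> inner (E a Y - E set0 Y) (E c W) =
  inner (E (a `&` c) Y) W - inner (E set0 Y) W.
  by move=> Ac; rewrite (ipBl ipP) !inner_E_E ?set0I//; exact: A0.
rewrite !EE// (ipBl ipP) key -setDE setIC -/B' -/C'; lra.
Qed.

Lemma additive_field_F a : A a -> additive_field a `<=` F a.
Proof. by move=> Aa; apply: additive_field_sub; [exact: FP|move=> Z []]. Qed.

(* On V = 1_D with D in F_a and C in K and F_(~a), E_K (1_C V) = 1_C E(V | G_a)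
   with G_a the additive field, and E_a (1_C X) is G_a-measurable by
   additive_of_sparse; so X and E_K X have the same integral over C and D. *)
Lemma sparse_step a K X : A a -> sparse a X -> sub_sigma_field P K ->
  additive_field a `<=` K -> K `<=` gen (additive_field a `|` F (~` a)) ->
  measurable_wrt (gen (F a `|` (K `&` F (~` a)))) X ->
  measurable_wrt K X.
Proof.
move=> Aa Xa KP aK Ka mX; have ACa := AC Aa.
have addP := additive_field_sub_sigma_field a.
have [_ Fm _] := FP Aa; have [_ FCm _] := FP ACa; have [_ addm _] := addP.
have [indep _] := FI Aa ACa (setICr a).
have KFP := sub_sigma_fieldI KP (FP ACa).
have MP : sub_sigma_field P (gen (F a `|` (K `&` F (~` a)))).
  by apply: gen_sub_sigma_field => B [/Fm|[_ /FCm]].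
have test B : gen (F a `|` (K `&` F (~` a))) B -> inner X (ind B) =
  inner (CE K X) (ind B).
  move: B; apply: inner_ind_rect => //; first exact: FP.
  move=> B C FB [KC FC]; have mB := Fm _ FB; have mC := FCm _ FC.
  have mV : measurable_wrt (F a) (ind B) by exact: measurable_wrt_ind.
  rewrite setIC ind_setI//; set Y := restr C X.
  have -> : inner X (restr C (ind B)) = inner Y (ind B) by rewrite inner_restr.
  have -> : inner (CE K X) (restr C (ind B)) = inner Y (CE K (ind B)).
    rewrite CE_sym// [RHS]inner_restr// [LHS](ipC ipP) [RHS](ipC ipP).
    exact: esym (nsqB0_ip ipP X (CE_restr (ind B) KP KC)).
  have e1 : nsq (CE (additive_field a) (ind B) - CE K (ind B)) = 0.
    have GP : sub_sigma_field P (gen (additive_field a `|` F (~` a))).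
      by apply: gen_sub_sigma_field => D [/addm|/FCm].
    have e := CE_indep addP (FP Aa) (FP ACa) (additive_field_F Aa) indep mV.
    apply: (ip_eq_nsqB0 ipP) => Z.
    rewrite -[RHS](nsqB0_ip ipP _ (CE_tower _ KP GP Ka)).
    rewrite -(nsqB0_ip ipP _ (CE_null KP e)).
    by rewrite -(nsqB0_ip ipP _ (CE_id KP (measurable_wrt_sub aK (measurable_wrt_CE
      _ addP)))).
  rewrite [RHS](ipC ipP) -(nsqB0_ip ipP _ e1).
  have mEY : measurable_wrt (additive_field a) (E a Y).
    rewrite (_ : E a Y = 1 *: (E a Y - E set0 Y) + E set0 Y);
      last by rewrite scale1r subrK.
    apply: measurable_wrt_linear.
      by apply: measurable_additive_field; exact: additive_of_sparse.
    exact: measurable_wrt_sub (F0_sub addP) (measurable_wrt_CE Y (FP A0)).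
  rewrite -(CE_inner Y (FP Aa) mV) [RHS](ipC ipP).
  rewrite -(CE_inner Y (FP Aa) (measurable_wrt_sub (additive_field_F Aa)
    (measurable_wrt_CE _ addP))).
  by rewrite [RHS](ipC ipP) (CE_inner _ addP mEY); exact: (ipC ipP).
have e : nsq (X - CE K X) = 0.
  (* [test] says that [X] is the projection of [CE K X] on a field for which [X] is measurable, so
     [X] itself may serve as a test vector; Pythagoras concludes. *)
  have XX : inner X X = inner (CE K X) X.
    have e : nsq (X - CE (gen (F a `|` (K `&` F (~` a)))) (CE K X)) =
      0 by exact: CE_unique.
    by rewrite {1}(nsqB0_ip ipP _ e) CE_inner.
  have KK := CE_inner X KP (measurable_wrt_CE X KP).
  by rewrite (nsqB ipP) /nsq KK (ipC ipP X (CE K X)) -XX; lra.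
by apply: (measurable_wrt_sqint KP (measurable_wrt_CE X KP)); rewrite (nsqBC ipP).
Qed.

(* The atoms are removed one at a time: F_(at_ i) is replaced by the additive
   field of at_ i, and sparse_step shows that X stays measurable. *)
Lemma sparse_measurable (I : finType) (at_ : I -> set T) G X :
  (forall i, A (at_ i)) -> (forall i j, i != j -> at_ i `&` at_ j = set0) ->
  (forall x, exists i, at_ i x) -> (forall i, sparse (at_ i) X) ->
  measurable_wrt (F setT) X ->
  sub_sigma_field P G -> (forall i, additive_field (at_ i) `<=` G) ->
  measurable_wrt G X.
Proof.
move=> Aat dis cov Xat mX GP addG.
(* Invariant of the induction: full information on the region [D] still untouched, additive
   information on every atom outside it. *)
pose gens D := F D `|` \bigcup_(i in [set i | at_ i `&` D =
  set0]) additive_field (at_ i).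
pose rest (s : seq I) := [set x | forall i, i \in s -> ~ at_ i x].
have gensm D : A D -> gens D `<=` measurable.
  move=> AD_ B [FB|[i _ addB]]; first by have [_ Fm _] := FP AD_; exact: Fm.
  by have [_ addm _] := additive_field_sub_sigma_field (at_ i); exact: addm.
have LP D : A D -> sub_sigma_field P (gen (gens D)).
  by move=> AD_; apply: gen_sub_sigma_field; exact: gensm.
have restS i s : rest (i :: s) = rest s `\` at_ i.
  apply/seteqP; split=> x /= xs.
    by split=> [j js|]; apply: xs; rewrite inE ?js ?orbT ?eqxx.
  by move=> j; rewrite inE => /orP[/eqP->|]; case: xs => // + _; apply.
have Arest s : A (rest s).
  elim: s => [|i s IH]; first by rewrite (_ : rest [::] = setT);
    [exact: AT|apply/seteqP; split].
  by rewrite restS; exact: AD.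
have main s : uniq s -> measurable_wrt (gen (gens (rest s))) X.
  elim: s => [_|i s IH /= /andP[nis us]].
    apply: measurable_wrt_sub mX; rewrite (_ : rest [::] = setT);
      last by apply/seteqP; split.
    by apply: subset_trans (@sub_gen _ _ _ _ _); exact: subsetUl.
  have irest : at_ i `<=` rest s.
    move=> x ix j js jx; have : (at_ i `&` at_ j) x by split.
    by rewrite dis//; apply: contraNneq nis => ->.
  set K := gen (gens (rest (i :: s))).
  have KP : sub_sigma_field P K by exact: LP.
  have subK : gens (rest (i :: s)) `<=` K by exact: sub_gen.
  have restC : rest (i :: s) `<=` ~` at_ i by rewrite restS => x [].
  have addF j : j != i -> additive_field (at_ j) `<=` F (~` at_ i).
    move=> ji; apply: subset_trans (additive_field_F (Aat j)) _.
    apply: F_mono => //; first exact: AC.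
    by move=> x jx ix; have : (at_ j `&` at_ i) x by []; rewrite dis.
  have ik : additive_field (at_ i) `<=` K.
    move=> B addB; apply: subK; right; exists i => //=.
    by rewrite restS setDIK.
  apply: (sparse_step (Aat i) (Xat i) KP ik).
    apply: gen_min; first apply: gen_sub_sigma_field.
      move=> B [addB|]; last by have [_ Fm _] := FP (AC (Aat i)); exact: Fm.
      by have [_ addm _] := additive_field_sub_sigma_field (at_ i); exact: addm.
    move=> B [FB|[j /= jr addB]]; apply: sub_gen.
      by right; apply: (F_mono _ _ restC) => //; exact: AC.
    by have [<-|ji] := eqVneq j i; [left|right; exact: (addF j)].
  apply: measurable_wrt_sub (IH us); apply: gen_min; first apply: gen_sub_sigma_field.
    move=> B [FB|[_ FB]]; first by have [_ Fm _] := FP (Aat i); exact: Fm.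
    by have [_ Fm _] := FP (AC (Aat i)); exact: Fm.
  have disi : at_ i `&` rest (i :: s) = set0 by rewrite restS setDIK.
  have [_ Frest] := FI (Aat i) (Arest (i :: s)) disi.
  have un : at_ i `|` rest (i :: s) = rest s by rewrite restS; exact: setDUK.
  rewrite un in Frest.
  move=> B [|[j /= jr addB]].
    rewrite Frest; apply: gen_mono => {}B [FB|FB]; [by left|right; split].
      by apply: subK; left.
    by apply: (F_mono _ _ restC) => //; exact: AC.
  apply: sub_gen; have [ji|ji] := eqVneq j i.
    by left; apply: (additive_field_F (Aat i)); rewrite -ji.
  right; split; last exact: (addF j).
  apply: subK; right; exists j => //=.
  by rewrite restS setIDA jr set0D.
apply: measurable_wrt_sub (main (enum I) (enum_uniq _)).
apply: gen_min => // B [|[i _]]; last exact: addG.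
rewrite (_ : rest _ = set0); first exact: F0_sub.
apply/seteqP; split=> x //= nx; have [i ix] := cov x.
by apply: (nx i) => //; rewrite mem_enum.
Qed.

End noise.

(** * Spectral components at a finite level *)

Section moebius.
Import mathcomp.boot.fintype mathcomp.boot.finset.
Local Close Scope classical_set_scope.
Context {I : finType} {R : realType}.
Implicit Types (B C S : {set I}).

(** Toggling [i] is a sign-reversing involution on the subsets. *)
Lemma sum_set_cancel (W : zmodType) (h : {set I} -> W) (i : I) :
  (forall B, i \notin B -> h (i |: B) = - h B) -> \sum_B h B = 0.
Proof.
move=> hi; rewrite (bigID (fun B => i \in B))/=.
rewrite (reindex_onto (fun B => i |: B) (fun B => B :\ i))/=; last first.
  by move=> B iB; rewrite setD1K.
rewrite (eq_bigl (fun B => i \notin B)); last first.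
  move=> B; rewrite setU11/=; apply/eqP/idP => [<-|/setU1K//].
  by rewrite !inE eqxx.
by rewrite -big_split/= big1// => B iB; rewrite hi// addNr.
Qed.

Lemma sum_interval_cancel (C B : {set I}) (s : {set I} -> R) :
  (forall i S, i \in B :\: C -> i \notin S -> s (i |: S) = - s S) ->
  \sum_(S : {set I}) (if (C \subset S) && (S \subset B) then s S else 0) =
  (C == B)%:R * s B.
Proof.
move=> sN; have [<-|CB] := eqVneq C B.
  rewrite (bigD1 C)//= subxx mul1r big1 ?addr0// => S SC.
  by rewrite -eqEsubset eq_sym (negbTE SC).
rewrite mul0r; have [sCB|nCB] := boolP (C \subset B); last first.
  rewrite big1// => S _; case: ifP => // /andP[CS SB].
  by rewrite (subset_trans CS SB) in nCB.
have /set0Pn[i iBC] : B :\: C != set0.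
  by rewrite setD_eq0; apply: contra CB => ?; rewrite eqEsubset sCB.
apply: (@sum_set_cancel _ _ i) => S iS; rewrite (sN i S iBC iS).
move: iBC; rewrite inE => /andP[iC iB].
have -> : (C \subset i |: S) = (C \subset S).
  apply/idP/idP => [/subsetP h|h]; last exact: subset_trans h (subsetUr _ _).
  apply/subsetP => x xC; have := h x xC; rewrite !inE => /orP[/eqP xi|//].
  by rewrite -xi xC in iC.
by rewrite subUset sub1set iB/=; case: ifP => _; rewrite ?oppr0.
Qed.

(** With the sign counted from the lower end this inverts sums over subsets ([comp_sum]);
    [moebius_down], with the sign counted from the upper end, gives orthogonality ([ip_comp]). *)
Lemma moebius_up C B :
  \sum_(S : {set I})
    (if (C \subset S) && (S \subset B) then (-1) ^+ #|S :\: C| else 0) =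
  (C == B)%:R :> R.
Proof.
rewrite sum_interval_cancel => [|i S]; last first.
  rewrite inE => /andP[iC iB] iS; have -> : (i |: S) :\: C = i |: (S :\: C).
    by apply/setP => x; rewrite !inE; have [->|] := eqVneq x i; rewrite ?iC.
  by rewrite cardsU1 !inE (negbTE iS) andbF exprS mulN1r.
by have [->|_] := eqVneq C B; rewrite ?mul0r// setDv cards0 mulr1.
Qed.

Lemma moebius_down C B :
  \sum_(S : {set I})
    (if (C \subset S) && (S \subset B) then (-1) ^+ #|B :\: S| else 0) =
  (C == B)%:R :> R.
Proof.
rewrite sum_interval_cancel => [|i S]; first by rewrite setDv cards0 mulr1.
rewrite inE => /andP[iC iB] iS.
have -> : #|B :\: S| = #|B :\: (i |: S)|.+1.
  rewrite (cardsD1 i (B :\: S)) inE iS iB add1n; congr (_.+1).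
  by apply: eq_card => x; rewrite !inE negb_or andbA.
by rewrite exprS mulN1r opprK.
Qed.

(** The source of the eigenvalue e^(-t |S|): the random set of kept atoms contains [S] when all
    atoms of [S] are kept. The proof expands the product of [rho + g i], whose factors are [rho] on
    [S] and 1 elsewhere. *)
Lemma sum_binomial_weights (rho : R) S :
  \sum_(B : {set I}) (if S \subset B then rho ^+ #|B| * (1 - rho) ^+ (#|I| - #|B|)
    else 0) = rho ^+ #|S|.
Proof.
have prodE (J : {set I}) (r : R) : \prod_i (if i \in J then r else 1) = r ^+ #|J|.
  by rewrite -big_mkcond/= prodr_const.
pose g i := if i \in S then 0 else 1 - rho.
have <- : \prod_i (rho + g i) = rho ^+ #|S|.
  rewrite -prodE; apply: eq_bigr => i _; rewrite /g; case: ifP => _; lra.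
rewrite (bigA_distr _ _ (fun=> rho) g)/=; apply: eq_bigr => J _.
case: ifPn => [/subsetP SJ|/subsetPn[i iS iJ]]; last first.
  by rewrite (bigD1 i)//= (negbTE iJ) /g iS mul0r.
rewrite -(cardsC J) addKn -!prodE -big_split/=; apply: eq_bigr => i _; rewrite inE /g.
case: ifPn => iJ; rewrite ?mulr1//= mul1r; case: ifPn => // /SJ.
by rewrite (negbTE iJ).
Qed.

End moebius.

Section spectral_components.
Import mathcomp.boot.fintype mathcomp.boot.finset.
Local Close Scope classical_set_scope.
Context {R : realType} {V : lmodType R} (ip : V -> V -> R) {I : finType}.
Variable e : {set I} -> V -> V.
Implicit Types (B C S : {set I}) (x y z : V).

Hypothesis ipP : semi_inner ip.
Hypothesis e_sym : forall B x y, ip (e B x) y = ip x (e B y).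
Hypothesis e_cap : forall B C x y, ip (e B x) (e C y) = ip (e (B :&: C) x) y.

Local Notation nsq := (nsq ip).

(* The component of x with spectral set S, by Moebius inversion of
   e B x = \sum_(S | S \subset B) comp S x. *)
Definition comp S x : V := \sum_(B :
  {set I} | B \subset S) (-1) ^+ #|S :\: B| *: e B x.

Lemma comp_sum B x : \sum_(S : {set I} | S \subset B) comp S x = e B x.
Proof.
rewrite /comp; under eq_bigr do rewrite big_mkcond/=.
rewrite big_mkcond/= (eq_bigr (fun S => \sum_(C : {set I})
  (if (C \subset S) && (S \subset B) then (-1) ^+ #|S :\: C| else 0) *: e C x));
    last first.
  move=> S _; case: ifP => SB; last first.
    by rewrite big1// => C _; rewrite andbF scale0r.
  by apply: eq_bigr => C _; rewrite andbT; case: ifP; rewrite ?scale0r.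
rewrite exchange_big/= (eq_bigr (fun C => (C == B)%:R *: e C x)); last first.
  by move=> C _; rewrite -scaler_suml moebius_up.
rewrite (bigD1 B)//= eqxx scale1r big1 ?addr0// => C /negbTE ->.
by rewrite scale0r.
Qed.

(** If [S] has an atom [i] outside [C], then [e C] does not see whether [i] is in [B], and the
    alternating terms cancel in pairs. *)
Lemma ip_comp_e S C x z : ip (comp S x) (e C z) = (S \subset C)%:R * ip (comp S x) z.
Proof.
rewrite /comp !(ip_suml ipP); have [SC|/subsetPn[i iS iC]] := boolP (S \subset C).
  rewrite mul1r; apply: eq_bigr => B BS.
  rewrite !(ipZl ipP) e_cap; congr (_ * ip (e _ _) _).
  by apply/setIidPl; exact: subset_trans BS SC.
rewrite mul0r big_mkcond/=; apply: (@sum_set_cancel _ _ _ i) => B iB.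
rewrite subUset sub1set iS/=; case: ifP => _; last by rewrite oppr0.
rewrite !(ipZl ipP) !e_cap.
have -> : (i |: B) :&: C = B :&: C.
  by apply/setP => x'; rewrite !inE; have [->|//] := eqVneq x' i;
    rewrite (negbTE iC) !andbF.
have -> : #|S :\: B| = #|S :\: (i |: B)|.+1.
  rewrite (cardsD1 i (S :\: B)) inE iB iS add1n; congr (_.+1).
  by apply: eq_card => x'; rewrite !inE negb_or andbA.
by rewrite exprS mulN1r mulNr opprK.
Qed.

Lemma ip_comp S S' x y : ip (comp S x) (comp S' y) = (S == S')%:R * ip (comp S x) y.
Proof.
rewrite (ipC ipP) {1}/comp (ip_suml ipP) -moebius_down mulr_suml.
rewrite big_mkcond/=; apply: eq_bigr => C _; case: (C \subset S') => /=; last first.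
  by rewrite andbF mul0r.
rewrite andbT (ipZl ipP) (ipC ipP) ip_comp_e.
by case: ifP; rewrite ?mul1r ?mul0r ?mulr0.
Qed.

(** Functional calculus of the commuting projections; by orthogonality, norms of such vectors are
    compared coefficient by coefficient. *)
Definition comb (f : {set I} -> R) x : V := \sum_S f S *: comp S x.

Lemma ip_comb f x z : ip (comb f x) z = \sum_S f S * ip (comp S x) z.
Proof. by rewrite (ip_suml ipP); apply: eq_bigr => S _; rewrite (ipZl ipP). Qed.

Lemma nsq_comb f x : nsq (comb f x) = \sum_S f S ^+ 2 * nsq (comp S x).
Proof.
rewrite /nsq ip_comb; apply: eq_bigr => S _; rewrite (ipC ipP) ip_comb.
rewrite (bigD1 S)//= big1 ?addr0 => [|S' S'S]; last first.
  by rewrite ip_comp (negbTE S'S) mul0r mulr0.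
by rewrite expr2 mulrA.
Qed.

Lemma combB f g x : comb f x - comb g x = comb (fun S => f S - g S) x.
Proof. by rewrite -sumrB; apply: eq_bigr => S _; rewrite scalerBl. Qed.

Lemma comb1 x : comb (fun=> 1) x = e setT x.
Proof.
rewrite -comp_sum /comb; apply: eq_big => [S|S _]; first by rewrite subsetT.
by rewrite scale1r.
Qed.

Lemma sum_e_comb (J : finType) (c : J -> R) (u : J -> {set I}) x :
  \sum_j c j *: e (u j) x = comb (fun S =>
    \sum_j (if S \subset u j then c j else 0)) x.
Proof.
rewrite /comb; under eq_bigr do rewrite -comp_sum scaler_sumr big_mkcond/=.
rewrite exchange_big/=; apply: eq_bigr => S _; rewrite scaler_suml.
by apply: eq_bigr => j _; case: ifP; rewrite ?scale0r.
Qed.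

Lemma comp_sym S x y : ip (comp S x) y = ip x (comp S y).
Proof.
rewrite (ipC ipP x) !(ip_suml ipP); apply: eq_bigr => B _.
by rewrite !(ipZl ipP) e_sym (ipC ipP x).
Qed.

(** Additivity for the empty set excludes the empty spectral set; for a singleton [[set i]] inside
    [S] it excludes two or more atoms, since [S] then fits neither in the singleton nor in its
    complement. *)
Lemma additive_comp x S y :
  (forall B y, ip x y = ip x (e B y) + ip x (e (~: B) y)) -> #|S| != 1 ->
  ip (comp S x) y = 0.
Proof.
move=> addx S1; rewrite comp_sym.
have xe B : ip x (e B (comp S y)) = (S \subset B)%:R * ip x (comp S y).
  by rewrite -e_sym (ipC ipP) ip_comp_e (ipC ipP).
have [S0|[i iS]] := set_0Vmem S.
  have := addx set0 (comp S y); rewrite !xe S0 !sub0set mul1r => h; lra.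
have := addx [set i] (comp S y); rewrite !xe.
have -> : S \subset [set i] = false.
  apply/negbTE; apply: contra S1; rewrite subset1 => /orP[/eqP->|/eqP S0].
    by rewrite cards1.
  by rewrite S0 inE in iS.
have -> : S \subset ~: [set i] = false.
  by apply/negbTE/subsetPn; exists i => //; rewrite !inE eqxx.
rewrite !mul0r => h; lra.
Qed.

End spectral_components.

(** * Comparison of a fine level with a coarser one *)

Section multiplicity_free.
Import mathcomp.boot.fintype mathcomp.boot.finset.
Local Close Scope classical_set_scope.
Context {R : realType} {V : lmodType R} (ip : V -> V -> R) {I J : finType}.
Variables (e : {set I} -> V -> V) (pi : I -> J).
Implicit Types (B C S : {set I}) (x y z : V).

Hypothesis ipP : semi_inner ip.
Hypothesis e_sym : forall B x y, ip (e B x) y = ip x (e B y).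
Hypothesis e_cap : forall B C x y, ip (e B x) (e C y) = ip (e (B :&: C) x) y.

Local Notation nsq := (nsq ip).

(** [Uapprox] with [rho] equal to e^(-t). The map [u] expresses the kept atoms in the atoms of a
    possibly finer level, so that two levels can be compared inside one decomposition. *)
Definition weighted (rho : R) (K : finType) (u : {set K} -> {set I}) x : V :=
  \sum_(B : {set K}) (rho ^+ #|B| * (1 - rho) ^+ (#|K| - #|B|)) *: e (u B) x.

(* The part of x whose spectral set has at most one atom in each fibre of pi. *)
Definition mult_free x : V :=
  comb e (fun S => if #|pi @: S| == #|S| then 1 else 0) x.

Lemma weighted_preimset (rho : R) x :
  weighted rho (fun B : {set J} => pi @^-1: B) x = comb e (fun S =>
    rho ^+ #|pi @: S|) x.
Proof.
rewrite /weighted sum_e_comb; congr comb; apply/funext => S.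
rewrite -sum_binomial_weights; apply: eq_bigr => B _.
by rewrite -sub_imset_pre.
Qed.

Lemma weighted_id (rho : R) x : weighted rho id x = comb e (fun S => rho ^+ #|S|) x.
Proof.
rewrite /weighted sum_e_comb; congr comb; apply/funext => S.
by rewrite -sum_binomial_weights.
Qed.

Lemma ip_weighted_additive (rho : R) x y :
  (forall B y, ip x y = ip x (e B y) + ip x (e (~: B) y)) ->
  ip (weighted rho id x) y = rho * ip (e setT x) y.
Proof.
move=> addx; rewrite weighted_id -comb1 !(ip_comb e ipP) mulr_sumr.
apply: eq_bigr => S _; rewrite mul1r; have [->|S1] := eqVneq #|S| 1%N.
  by rewrite expr1.
by rewrite (additive_comp ipP e_sym e_cap _ addx S1) !mulr0.
Qed.

(* Componentwise, with k < n the sizes of pi @: S and S: either rho ^+ n <= 1/2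
   and 1 - rho ^+ n is large, or rho ^+ k - rho ^+ n is. *)
Lemma mult_free_error (rho : R) x : 0 < rho -> rho < 1 ->
  nsq (e setT x - mult_free x) <=
    4 * nsq (e setT x - weighted rho id x) +
    4 / (rho^-1 - 1) ^+ 2 *
      nsq (weighted rho (fun B : {set J} => pi @^-1: B) x - weighted rho id x).
Proof.
move=> rho0 rho1; set X := weighted rho id x; set Y := weighted _ _ x.
rewrite /X weighted_id /Y weighted_preimset -comb1 /mult_free !combB !(nsq_comb ipP
  e_cap).
rewrite !mulr_sumr -big_split/=; apply: ler_sum => S _.
rewrite (mulrA 4) (mulrA (4 / _)) -mulrDl ler_wpM2r ?(nsq_ge0 ipP)//.
have inv1 : 0 < rho^-1 - 1 by rewrite subr_gt0 invf_gt1.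
have sq0 : 0 <= 4 / (rho^-1 - 1) ^+ 2 by rewrite divr_ge0// exprn_ge0// ltW.
case: ifPn => [_|bad].
  by rewrite subrr expr0n/=; apply: addr_ge0; apply: mulr_ge0; rewrite ?sqr_ge0.
rewrite subr0 expr1n.
have lt : (#|pi @: S| < #|S|)%N by rewrite ltn_neqAle bad leq_imset_card.
have n0 : 0 < rho ^+ #|S| by rewrite exprn_gt0.
(* In the first case [1 <= 4 * (1 - rho ^+ #|S|) ^+ 2]. In the second, losing at least one atom
   costs at least [(rho^-1 - 1) * rho ^+ #|S|], hence [(rho^-1 - 1) / 2], whose inverse square is
   the second constant. *)
have [small|big] := leP (rho ^+ #|S|) 2^-1.
  apply: ler_wpDr; first by rewrite mulr_ge0// sqr_ge0.
  by move: small; set r := rho ^+ _; nra.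
apply: ler_wpDl; first by rewrite mulr_ge0// sqr_ge0.
have gap : (rho^-1 - 1) / 2 <= rho ^+ #|pi @: S| - rho ^+ #|S|.
  have : rho ^+ #|S|.-1 <= rho ^+ #|pi @: S|.
    by rewrite ler_wiXn2l ?ltW// -ltnS prednK//; exact: leq_ltn_trans lt.
  have -> : rho ^+ #|S|.-1 = rho^-1 * rho ^+ #|S|.
    rewrite -[in RHS](@prednK #|S|)
      ?(leq_ltn_trans _ lt)// exprS mulrA mulVf ?mul1r//.
    by rewrite gt_eqF.
  by move: big inv1; set r := rho ^+ _; set q := rho^-1 => ? ? ?; nra.
rewrite mulrAC ler_pdivlMr ?exprn_gt0// mul1r.
by move: gap inv1; set g := _ - _; set q := rho^-1 - 1 => ? ?; nra.
Qed.

(** Inclusion-exclusion on the events that [S] avoids [B] or avoids [C]. It could fail only for an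
    [S] meeting both, which would have two atoms in one fibre. *)
Lemma ip_mult_free x B C z : B :&: C = set0 ->
  (forall i j, i \in B -> j \in C -> pi i = pi j) ->
  ip (mult_free x) z = ip (mult_free x) (e (~: B) z) + ip (mult_free x) (e (~: C) z)
                       - ip (mult_free x) (e (~: (B :|: C)) z).
Proof.
move=> BC piBC; rewrite /mult_free !(ip_comb e ipP) -big_split/= -sumrB;
  apply: eq_bigr => S _.
rewrite !(ip_comp_e ipP e_cap); case: ifPn => [good|]; last by lra.
have inj := imset_injP good.
rewrite !subsets_disjoint !setCK -!setI_eq0 setIUr setU_eq0.
have [//|/set0Pn[i /setIP[iS iB]]] := eqVneq (S :&: B) set0; first by rewrite /=; lra.
have [//|/set0Pn[j /setIP[jS jC]]] := eqVneq (S :&: C) set0; first by rewrite /=; lra.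
have ij : i = j by apply: inj => //; exact: piBC.
have : i \in B :&: C by rewrite inE iB ij.
by rewrite BC inE.
Qed.

(** A discarded [S] contains two atoms [i], [j] of one fibre, and all three projections on the right
    of the hypothesis annihilate its component. *)
Lemma ip_mult_free_orth x z :
  (forall i j, i != j -> pi i = pi j -> forall w, ip z w = ip z (e (~: [set i]) w) +
     ip z (e (~: [set j]) w) - ip z (e (~: [set i; j]) w)) ->
  ip (e setT x - mult_free x) z = 0.
Proof.
move=> zP; rewrite -comb1 /mult_free combB (ip_comb e ipP) big1// => S _.
case: ifPn => [_|bad]; first by rewrite subrr mul0r.
have /dinjectivePn : ~~ dinjectiveb pi S.
  by apply: contra bad => /dinjectiveP pinj; exact/eqP/card_in_imset.
move=> [i iS [j /andP[ji jS] pij]].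
rewrite subr0 mul1r (ipC ipP) (zP i j)//; last by rewrite eq_sym.
rewrite -!e_sym !(ipC ipP (e _ _)) !(ip_comp_e ipP e_cap).
have -> : S \subset ~: [set i] = false.
  by apply/negbTE/subsetPn; exists i => //; rewrite !inE eqxx.
have -> : S \subset ~: [set j] = false.
  by apply/negbTE/subsetPn; exists j => //; rewrite !inE eqxx.
have -> : S \subset ~: [set i; j] = false.
  by apply/negbTE/subsetPn; exists i => //; rewrite !inE eqxx.
by rewrite !mul0r subr0 addr0.
Qed.

End multiplicity_free.

(** * Atoms of a finite algebra *)

Lemma card_fset_set_image (I : finType) (U : choiceType) (f : I -> U) (S : {set I}) :
  injective f -> #|` fset_set [set f i | i in [set` S]]| = #|S|.
Proof.
move=> finj; have -> : fset_set [set f i | i in [set` S]] = [fset f i | i in S]%fset.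
  apply/fsetP => y; rewrite in_fset_set; last exact/finite_image/finite_finset.
  apply/idP/imfsetP => [/set_mem[i iS <-]|[i iS ->]]; first by exists i.
  by apply/mem_set; exists i.
by rewrite card_imfset// cardE.
Qed.

Section atoms.
Context {T : Type}.
Implicit Types (B : set (set T)).

Definition join_atoms (I : finType) (at_ : I -> set T) (S : {set I}) : set T :=
  [set x | exists2 i, i \in S & at_ i x].

(** Indexing the atoms by a [finType] turns sums over the algebra into sums over [{set I}]; the last
    clause is the link with [atom_weight], which counts [atoms B]. *)
Definition atom_basis (B : set (set T)) (I : finType) (at_ : I -> set T) : Prop :=
  [/\ forall i, at_ i !=set0,
      forall i j, i != j -> at_ i `&` at_ j = set0,
      forall x, exists i, at_ i x,
      B = range (join_atoms at_)
    & range at_ = atoms B].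

(** The atom is the member containing [x] with the fewest members of [B] below it. *)
Lemma set_algebra_atom B x : set_algebra B -> finite_set B ->
  exists2 a, atoms B a & a x.
Proof.
move=> [B0 BU BC] finB.
have BT : B setT by rewrite -setC0; exact: BC.
have BD b c : B b -> B c -> B (b `\` c).
  move=> Bb Bc; rewrite -(setCK (b `\` c)); apply: (BC).
  by rewrite setCD; apply: (BU) => //; exact: (BC).
pose n b := #|` fset_set [set c | B c /\ c `<=` b]|.
have ex : exists k, `[< exists b, [/\ B b, b x & n b = k] >].
  by exists (n setT); apply/asboolP; exists setT.
case: (ex_minnP ex) => k /asboolP[b [Bb bx nb]] kmin; exists b => //.
have main c : B c -> c `<=` b -> c x -> c = b.
  move=> Bc cb cx; apply: contrapT => cneqb.
  have /kmin : `[< exists b, [/\ B b, b x & n b = n c] >] by apply/asboolP; exists c.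
  rewrite -nb leqNgt => /negP; apply; apply: fproper_ltn_card.
  have fin a : finite_set [set c | B c /\ c `<=` a] by apply: sub_finite_set finB
    => ? [].
  rewrite fproperEneq; apply/andP; split.
    apply/eqP => /fsetP /(_ b); rewrite !in_fset_set// => cb'.
    have : b \in [set c0 | B c0 /\ c0 `<=` c] by rewrite cb'; apply/mem_set; split.
    by move=> /set_mem[_ bc]; apply: cneqb; rewrite eqEsubset.
  apply/fsubsetP => y; rewrite !in_fset_set// => /set_mem[By yc]; apply/mem_set;
    split => //.
  exact: subset_trans cb.
split => //; first by exists x.
move=> c Bc cb; have [cx|ncx] := pselect (c x); [by right; exact: main|left].
have := main _ (BD _ _ Bb Bc) (@subDsetl _ _ _) (conj bx ncx) => bcb.
by rewrite -(setIidr cb) -bcb setDKI.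
Qed.

Lemma atom_basis_exists B : set_algebra B -> finite_set B ->
  exists (I : finType) (at_ : I -> set T), atom_basis B at_.
Proof.
move=> algB finB; have [B0 BU BC] := algB.
have BI b c : B b -> B c -> B (b `&` c).
  by move=> Bb Bc; rewrite -(setCK (b `&` c)) setCI; apply: (BC); apply: (BU);
    exact: (BC).
have finA : finite_set (atoms B) by apply: sub_finite_set finB => ? [].
exists (fset_set (atoms B) : finType), val.
have atP (i : fset_set (atoms B)) : atoms B (val i).
  by have := valP i; rewrite in_fset_set// => /set_mem.
have atE a : atoms B a -> exists i : fset_set (atoms B), val i = a.
  move=> Aa; have aA : a \in fset_set (atoms B) by rewrite in_fset_set//;
    exact/mem_set.
  by exists [` aA]%fset.
have dec a b x : atoms B a -> B b -> a x -> b x -> a `<=` b.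
  move=> [Ba _ amin] Bb ax bx; have [e|<-] := amin _ (BI _ _ Ba Bb)
    (@subIsetl _ _ _); last first.
    exact: subIsetr.
  by have : (a `&` b) x by []; rewrite e.
split.
- by move=> i; have [] := atP i.
- move=> i j ij; apply/seteqP; split => // x [ix jx].
  move/eqP: ij; apply; apply: val_inj; apply/seteqP; split; apply: (dec _ _ x) => //;
    by [exact: atP|have [] := atP i|have [] := atP j].
- move=> x; have [a /atE[i <-] ax] := set_algebra_atom x algB finB; by exists i.
- apply/seteqP; split => [b Bb|_ [S _ <-]].
    exists [set i | `[< val i `<=` b >]]%SET => //; apply/seteqP; split => x /=.
      by move=> [i]; rewrite inE => /asboolP; apply.
    move=> bx; have [a /[dup] Aa /atE[i ia] ax] := set_algebra_atom x algB finB.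
    exists i; last by rewrite ia.
    by rewrite inE; apply/asboolP; rewrite ia; exact: dec Aa Bb ax bx.
  rewrite (_ : join_atoms _ _ = \big[setU/set0]_(i in S) val i).
    by elim/big_ind : _ => // i _; have [] := atP i.
  apply/seteqP; split=> x /=.
    by move=> [i iS ix]; rewrite (bigD1 i)//=; left.
  by elim/big_ind : _ => // [b c hb hc [/hb|/hc]//|i iS ix]; exists i.
- apply/seteqP; split => [_ [i _ <-]|a /atE[i <-]]; [exact: atP|by exists i].
Qed.

Section basis.
Context (B : set (set T)) (I : finType) (at_ : I -> set T).
Hypothesis basisB : atom_basis B at_.
Local Notation u := (join_atoms at_).

Lemma atom_eq i j x : at_ i x -> at_ j x -> i = j.
Proof.
move=> ix jx; apply: contrapT => /eqP ij; case: basisB => _ /(_ _ _ ij) e _ _ _.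
by have : (at_ i `&` at_ j) x by []; rewrite e.
Qed.

Lemma atom_inj : injective at_.
Proof.
move=> i j ij; case: basisB => /(_ i)[x ix] _ _ _ _.
by apply: (@atom_eq i j x) => //; rewrite -ij.
Qed.

Lemma join_atomsP S i x : at_ i x -> u S x <-> i \in S.
Proof. by move=> ix; split=> [[j jS jx]|iS]; [rewrite (atom_eq ix jx)|exists i]. Qed.

Lemma join_atoms_inj : injective u.
Proof.
move=> S S' SS'; apply/setP => i; case: basisB => /(_ i)[x ix] _ _ _ _.
by apply/idP/idP => /(join_atomsP _ ix) h; apply/(join_atomsP _ ix);
  [rewrite -SS'|rewrite SS'].
Qed.

Lemma join_atomsI S S' : u (S :&: S') = u S `&` u S'.
Proof.
case: basisB => _ _ cov _ _; apply/seteqP; split=> x; have [i ix] := cov x.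
  by move=> /(join_atomsP _ ix); rewrite inE => /andP[iS iS']; split;
    apply/(join_atomsP _ ix).
move=> [/(join_atomsP _ ix) iS /(join_atomsP _ ix) iS'].
by apply/(join_atomsP _ ix); rewrite inE iS.
Qed.

Lemma join_atomsC S : u (~: S) = ~` u S.
Proof.
case: basisB => _ _ cov _ _; apply/seteqP; split=> x; have [i ix] := cov x.
  by move=> /(join_atomsP _ ix); rewrite inE => /negP iS /(join_atomsP _ ix).
by move=> nS; apply/(join_atomsP _ ix); rewrite inE;
  apply/negP => /(join_atomsP _ ix).
Qed.

Lemma join_atomsU S S' : u (S :|: S') = u S `|` u S'.
Proof. by apply: setC_inj; rewrite setCU -!join_atomsC -join_atomsI finset.setCU. Qed.

Lemma join_atoms1 i : u [set i] = at_ i.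
Proof.
by apply/seteqP; split=> x; [move=> [j /set1P->]|exists i => //; exact/set1P].
Qed.

Lemma join_atomsT : u [set: I] = setT.
Proof.
case: basisB => _ _ cov _ _; apply/seteqP; split=> // x _.
by have [i ix] := cov x; exists i.
Qed.

Lemma join_atoms_mem S : B (u S).
Proof. by case: basisB => _ _ _ -> _; exists S. Qed.

Lemma join_atomsE b : B b -> exists S, b = u S.
Proof. by case: basisB => _ _ _ -> _ [S _ <-]; exists S. Qed.

Lemma atom_mem i : B (at_ i).
Proof. by rewrite -join_atoms1; exact: join_atoms_mem. Qed.

Lemma atom_weight_join {R : realType} (p : R) S :
  atom_weight p B (u S) = p ^+ #|S| * (1 - p) ^+ (#|I| - #|S|).
Proof.
have [_ _ _ _ atomsE] := basisB; rewrite /atom_weight.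
have -> : #|` fset_set (atoms B)| = #|I|.
  rewrite -atomsE -cardsT -(card_fset_set_image _ atom_inj); congr (#|` fset_set _ |).
  by apply/seteqP; split => _ [i _ <-]; exists i => //=; rewrite inE.
have -> // : #|` fset_set [set b | atoms B b /\ b `<=` u S]| = #|S|.
rewrite -(card_fset_set_image _ atom_inj) -atomsE; congr (#|` fset_set _ |).
apply/seteqP; split => [_ [[i _ <-] iu]|_ [i /= iS <-]].
  exists i => //=; case: basisB => /(_ i)[x ix] _ _ _ _.
  exact/(join_atomsP _ ix)/iu.
by split; [exists i|move=> x ix; apply/(join_atomsP _ ix)].
Qed.

End basis.

End atoms.

(** * Stable elements *)

Section stable.
Context {R : realType} {d : measure_display} {Omega : measurableType d}.
Variable P : probability Omega R.
Context {T : Type}.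
Variables (A : set (set T)) (F : set T -> set (set Omega)).
Variables (Am : nat -> set (set T)) (J : nat -> finType).
Variable at_ : forall m, J m -> set T.
Local Notation sqint := (sqint P).
Local Notation inner := (@inner _ _ _ P).
Local Notation nsq := (nsq inner).
Local Notation ipP := (inner_semi_inner P).
Local Notation gen := (gen_sigma_field P).
Implicit Types (X Y Z : sqint).

Hypothesis algA : set_algebra A.
Hypothesis FP : forall a, A a -> sub_sigma_field P (F a).
Hypothesis FI : forall a b, A a -> A b -> a `&` b = set0 ->
  independent_fields P (F a) (F b) /\ F (a `|` b) = gen (F a `|` F b).
Hypothesis exhA : exhaustion A Am.
Hypothesis basis : forall m, atom_basis (Am m) (at_ (m := m)).

Local Notation E a := (CE (P := P) (F a)).
Local Notation u m := (join_atoms (at_ (m := m))).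
Local Notation e m := (fun S : {set J m} => E (u m S)).

Lemma Am_sub m : Am m `<=` A.
Proof. by have [_ _ <-] := exhA; exact: bigcup_sup. Qed.

Lemma Am_mono m n : (m <= n)%N -> Am m `<=` Am n.
Proof.
have [_ Ams _] := exhA; elim: n => [|n IH]; first by rewrite leqn0 => /eqP->.
by rewrite leq_eqVlt ltnS => /orP[/eqP->//|/IH mn]; exact: subset_trans mn (Ams _).
Qed.

Lemma A_join m S : A (u m S).
Proof. exact/Am_sub/(join_atoms_mem (basis m)). Qed.

Lemma e_sym m S X Y : inner (e m S X) Y = inner X (e m S Y).
Proof. by apply: CE_sym; exact/FP/A_join. Qed.

Lemma e_cap m S S' X Y : inner (e m S X) (e m S' Y) = inner (e m (S :&: S') X) Y.
Proof.
rewrite /= (inner_E_E algA FP FI) ?(join_atomsI (basis m))//; exact: A_join.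
Qed.

Lemma sqint_sumE (K : finType) (f : K -> sqint) w : (\sum_k f k) w = \sum_k f k w.
Proof. by elim/big_rec2 : _ => // k y z _ <-. Qed.

Lemma UapproxE m t X : Uapprox P F Am m t X = weighted (e m) (expR (- t)) id X.
Proof.
apply/funext => w; rewrite /Uapprox /weighted sqint_sumE.
have [_ _ _ AmE _] := basis m.
rewrite [X in \sum_(a \in X) _]AmE fsbig_image; last by move=> S S' _ _;
  exact: join_atoms_inj (basis m) _ _.
have -> : [set: {set J m}] = [set` index_enum {set J m}].
  by apply/seteqP; split => S // _ /=; rewrite mem_index_enum.
rewrite -fsbig_seq ?index_enum_uniq//; apply: eq_bigr => S _.
by rewrite (atom_weight_join (basis m)) sqintZE CEE//; exact/FP/A_join.
Qed.

Definition atom_map m M (pi : J M -> J m) : Prop := forall i, at_ i `<=` at_ (pi i).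

Lemma atom_map_exists m M : (m <= M)%N -> exists pi : J M -> J m, atom_map pi.
Proof.
move=> mM; suff /choice[pi piP] : forall i : J M, exists j :
  J m, at_ i `<=` at_ j by exists pi.
move=> i; have [_ _ cov _ _] := basis m.
have [/(_ i)[x ix] _ _ _ _] := basis M; have [j jx] := cov x.
exists j; have /(join_atomsE (basis M))[S jS] := Am_mono mM (atom_mem (basis m) j).
have iS : i \in S by apply/(join_atomsP (basis M) _ ix); rewrite -jS.
by rewrite jS => y iy; apply/(join_atomsP (basis M) _ iy).
Qed.

Lemma join_atoms_map m M (pi : J M -> J m) (S : {set J m}) :
  atom_map pi -> u m S = u M (pi @^-1: S).
Proof.
move=> mpi; have [_ _ cov _ _] := basis M; apply/seteqP; split=> x;
  have [i ix] := cov x.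
  move=> /(join_atomsP (basis m) _ (mpi _ _ ix)) iS.
  by apply/(join_atomsP (basis M) _ ix); rewrite inE.
move=> /(join_atomsP (basis M) _ ix); rewrite inE => iS.
exact/(join_atomsP (basis m) _ (mpi _ _ ix)).
Qed.

Lemma weighted_map m M (pi : J M -> J m) rho X : atom_map pi ->
  weighted (e m) rho id X = weighted (e M) rho (fun B : {set J m} => pi @^-1: B) X.
Proof.
by move=> mpi; apply: eq_bigr => B _; congr (_ *: CE (F _) _); exact: join_atoms_map.
Qed.

Lemma mult_free_sparse m M (pi : J M -> J m) X (j : J m) B C Z : atom_map pi ->
  Am M B -> Am M C -> B `&` C = set0 -> B `<=` at_ j -> C `<=` at_ j ->
  let Y := mult_free (e M) pi X in
  inner Y Z = inner Y (E (~` B) Z) + inner Y (E (~` C) Z)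
    - inner Y (E (~` (B `|` C)) Z).
Proof.
move=> mpi /(join_atomsE (basis M))[S ->] /(join_atomsE (basis M))[S' ->] dis Sj
  S'j Y.
rewrite -(join_atomsU (basis M)) -!(join_atomsC (basis M)).
apply: (ip_mult_free (e := e M) (pi := pi) ipP (@e_cap M) X).
  apply: (join_atoms_inj (basis M)); rewrite (join_atomsI (basis M)) dis.
  by apply/seteqP; split => // x [i]; rewrite inE.
have piE i : u M [set i] `<=` at_ j -> pi i = j.
  have [/(_ i)[x ix] _ _ _ _] := basis M => /(_ x);
    rewrite (join_atoms1 (at_ (m := M))).
  by move=> /(_ ix); exact: atom_eq (basis m) _ _ _ (mpi i x ix).
have sub (S0 : {set J M}) i : i \in S0 -> u M [set i] `<=` u M S0.
  by move=> iS x [k /set1P-> ix]; exists i.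
move=> i k iS kS'; rewrite (piE i) ?(piE k)//.
  exact: subset_trans (sub _ _ kS') S'j.
exact: subset_trans (sub _ _ iS) Sj.
Qed.

(** The part at the finer level satisfies the sparsity identity for two atoms of [Am M] in one
    fibre, which is the hypothesis of [ip_mult_free_orth]. *)
Lemma mult_free_orth m M M' (pi : J M -> J m) (pi' : J M' -> J m) X : (M <= M')%N ->
  atom_map pi -> atom_map pi' ->
  inner (E setT X - mult_free (e M) pi X) (mult_free (e M') pi' X) = 0.
Proof.
move=> MM' mpi mpi'; rewrite -(join_atomsT (basis M)).
apply: (ip_mult_free_orth (e := e M) ipP (@e_sym M) (@e_cap M) X) => i j ij pij W.
have Ami k : Am M' (at_ (k : J M)) by apply: (Am_mono MM');
  exact: atom_mem (basis M) k.
rewrite !(join_atomsC (basis M)) (join_atomsU (basis M))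
  !(join_atoms1 (at_ (m := M))).
apply: (mult_free_sparse X (j := pi i)) => //.
  by have [_ /(_ i j ij)] := basis M.
by rewrite pij; exact: mpi.
Qed.

Lemma measurable_wrt_sum G (K : finType) (Q : pred K) (f : K -> sqint) :
  (forall k, measurable_wrt G (f k)) -> measurable_wrt G (\sum_(k | Q k) f k).
Proof.
move=> mf; elim/big_rec : _ => [|k Y _ mY]; first exact: measurable_wrt_cst.
by rewrite -[f k]scale1r; exact: measurable_wrt_linear.
Qed.

Lemma measurable_mult_free m M (pi : J M -> J m) X :
  measurable_wrt (F setT) (mult_free (e M) pi X).
Proof.
have Z0 : measurable_wrt (F setT) (0 : sqint) by exact: measurable_wrt_cst.
apply: measurable_wrt_sum => S; rewrite -[_ *: _]addr0;
  apply: measurable_wrt_linear => //.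
apply: measurable_wrt_sum => C; rewrite -[_ *: _]addr0;
  apply: measurable_wrt_linear => //.
apply: (measurable_wrt_sub _ (measurable_wrt_CE _ (FP (A_join _)))).
by apply: (F_mono algA FI) => //; [exact: A_join|exact: AT].
Qed.

(* Y is the limit in M of the parts of X having at most one atom of Am M in each
   atom of Am m; the differences are orthogonal, so the norms decrease. *)
Lemma stable_approx m X : exists2 Y : sqint,
  measurable_wrt (F setT) Y /\ (forall j : J m, sparse A F (at_ j) Y) &
  forall rho W, 0 < rho -> rho < 1 ->
    nsq (weighted (e M) rho id X - W) @[M --> \oo] --> 0 ->
    nsq (E setT X - Y) <= 4 * nsq (E setT X - W) +
      4 / (rho^-1 - 1) ^+ 2 * nsq (weighted (e m) rho id X - W).
Proof.
have ex k : exists pi : J (k + m)%N -> J m, atom_map pi.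
  by apply: atom_map_exists; exact: leq_addl.
pose pi k := sval (cid (ex k)).
have mpi k : atom_map (pi k) by rewrite /pi; case: cid.
pose Y_ k := mult_free (e (k + m)%N) (pi k) X.
have orth n k : (n <= k)%N -> inner (Y_ n) (Y_ k) = inner (E setT X) (Y_ k).
  move=> nk; have nkm : (n + m <= k + m)%N by rewrite leq_add2r.
  have := mult_free_orth X nkm (mpi n) (mpi k).
  by rewrite (ipBl ipP) => /eqP; rewrite subr_eq0 => /eqP ->.
have Yc : nsq_cauchy inner Y_.
  apply: (nsq_decreasing_cauchy ipP) => n k nk.
  by rewrite (nsqB ipP) (orth n k nk) -(orth k k (leqnn k)) /nsq; lra.
have mY k : measurable_wrt (F setT) (Y_ k) by exact: measurable_mult_free.
have [Y mYY YY] := sqint_complete (FP (AT algA)) mY Yc.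
exists Y; first split => // j B C AB AC BC Bj Cj Z.
  have [N [NB NC]] : exists N, Am N B /\ Am N C.
    have [_ _ AE] := exhA; move: AB AC; rewrite -AE => -[n1 _ B1] [n2 _ C2].
    exists (maxn n1 n2); split; [apply: (Am_mono (leq_maxl n1 n2))|apply: (Am_mono
      (leq_maxr n1 n2))] => //.
  pose f X := inner X Z - (inner X (E (~` B) Z) + inner X (E (~` C) Z)
    - inner X (E (~` (B `|` C)) Z)).
  (* The defect [f] is continuous, and it vanishes at [Y_ k] once [B] and [C] belong to level
     [k + m]. *)
  have fc : f (Y_ k) @[k --> \oo] --> f Y.
    by apply: cvgB; [|apply: cvgB; [apply: cvgD|]]; exact: (cvg_ip ipP).
  have f0 : f (Y_ k) @[k --> \oo] --> 0.
    apply: cvg_near_cst; exists N => // k /= Nk; apply/eqP; rewrite subr_eq0;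
      apply/eqP.
    have NM : (N <= k + m)%N by exact: leq_trans Nk (leq_addr _ _).
    by apply: (mult_free_sparse X Z (j := j) (mpi k)) => //; exact: (Am_mono NM).
  have : f Y = 0 by exact: (cvg_unique (@norm_hausdorff _ _) fc f0).
  by move=> /eqP; rewrite /f subr_eq0 => /eqP.
move=> rho W rho0 rho1; rewrite -(cvg_shiftn m) => UW.
have l1 := cvg_nsqB ipP (z := E setT X) YY.
have l2 := cvg_nsqB ipP (z := E setT X) UW.
have l3 := cvg_nsqB ipP (z := weighted (e m) rho id X) UW.
have l4 : 4 * nsq (E setT X - weighted (e (k + m)%N) rho id X) +
   4 / (rho^-1 - 1) ^+ 2 * nsq (weighted (e m) rho id X - weighted (e (k + m)%N)
     rho id X)
   @[k --> \oo] -->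
   4 * nsq (E setT X - W) + 4 / (rho^-1 - 1) ^+ 2 * nsq (weighted (e m) rho id X - W).
  by apply: cvgD; apply: cvgMr.
(* The inequality is [mult_free_error] at level [k + m], with the weights of level [m] read there
   through [pi k]. *)
apply: (ler_cvg_to l1 l4); apply: nearW => k.
have := mult_free_error (e := e (k + m)%N) (pi k) ipP (@e_cap (k + m)%N) X rho0 rho1.
by rewrite -(weighted_map _ _ (mpi k)) /= (join_atomsT (basis (k + m)%N)).
Qed.

(** * From the approximations to [U], [H1] and stability *)

Lemma cvg_sqrt_EFin (K : Type) (Fi : set_system K) (f : K -> R) : Filter Fi ->
  (forall k, 0 <= f k) ->
  ((Num.sqrt (f k))%:E @[k --> Fi] --> 0%E) <-> (f k @[k --> Fi] --> 0).
Proof.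
move=> FF f0; split.
  move=> /fine_cvgP[_ s0]; have h := cvgM s0 s0; rewrite mulr0 in h.
  rewrite (_ : f = (fun k => Num.sqrt (f k) * Num.sqrt (f k))); first exact: h.
  by apply/funext => k; rewrite -expr2 sqr_sqrtr.
move=> fk; apply: cvg_EFin; first exact: nearW.
have h : Num.sqrt (f k) @[k --> Fi] --> Num.sqrt (0 : R).
  by apply: continuous_cvg => //; exact: sqrt_continuous.
by rewrite sqrtr0 in h.
Qed.

Lemma L2dist_cvg (K : Type) (Fi : set_system K) (x y : K -> sqint) : Filter Fi ->
  (L2dist P (x k) (y k) @[k --> Fi] --> 0%E) <->
  (nsq (x k - y k) @[k --> Fi] --> 0).
Proof.
move=> FF; rewrite -(cvg_sqrt_EFin FF) => [|k]; last exact: (nsq_ge0 ipP).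
by under eq_fun do rewrite L2distE.
Qed.

Definition U_rep t X : sqint := mk_sqint P (U P F Am t X).

Lemma U_L2 t X : L2 P (F setT) (U P F Am t X).
Proof.
rewrite /U; case: xgetP => [f _ []//|_]; split; first exact: Lfun_cst.
exact: measurable_wrt_cst.
Qed.

Lemma U_repE t X : U_rep t X = U P F Am t X :> (_ -> _).
Proof. by apply: mk_sqintE; have [] := U_L2 t X. Qed.

Lemma U_rep_cvg t X Y : measurable_wrt (F setT) Y ->
  nsq (weighted (e M) (expR (- t)) id X - Y) @[M --> \oo] --> 0 ->
  nsq (weighted (e M) (expR (- t)) id X - U_rep t X) @[M --> \oo] --> 0.
Proof.
move=> mY XY; apply/L2dist_cvg; rewrite U_repE /U.
have UY : [set f : Omega -> R | L2 P (F setT) f /\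
    L2dist P (Uapprox P F Am m t X) f @[m --> \oo] --> 0%E] Y.
  split; first by split => //; exact: sqint_Lfun.
  by under eq_fun do rewrite UapproxE; apply/L2dist_cvg.
by have [_] := xgetI (cst 0) UY; under eq_fun do rewrite UapproxE.
Qed.

(* When the limit defining U does not exist, U returns the junk value 0. *)
Lemma U_rep_dichotomy t X :
  nsq (weighted (e M) (expR (- t)) id X - U_rep t X)
    @[M --> \oo] --> 0 \/ U_rep t X = 0.
Proof.
rewrite /U_rep /U; case: xgetP => [f _ [[Lf mf] fX]|_]; [left|right].
  apply/L2dist_cvg; rewrite mk_sqintE//.
  by move: fX; under eq_fun do rewrite UapproxE.
by apply/LfuneqP => w; rewrite mk_sqintE//; exact: Lfun_cst.
Qed.

(** At every level the spectral sets of [Z] are single atoms, so each approximation already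
    multiplies [Z] by e^(-t); this also shows that the limit exists. *)
Lemma U_rep_additive t a Z : A a -> additive_on A F a Z ->
  nsq (U_rep t Z - expR (- t) *: Z) = 0.
Proof.
move=> Aa [mZ addZ].
have mZT : measurable_wrt (F setT) Z.
  by apply: measurable_wrt_sub mZ; apply: (F_mono algA FI) => //; exact: AT algA.
have UZ M : nsq (weighted (e M) (expR (- t)) id Z - expR (- t) *: Z) = 0.
  apply: (ip_eq_nsqB0 ipP) => W.
  rewrite (ip_weighted_additive ipP (@e_sym M) (@e_cap M)); last first.
    by move=> B V; rewrite (join_atomsC (basis M)); apply: addZ; exact: A_join.
  rewrite (join_atomsT (basis M)) (ipZl ipP).
  by rewrite -(nsqB0_ip ipP _ (CE_id (FP (AT algA)) mZT)).
have cZ : nsq (weighted (e M) (expR (- t)) id Z - expR (- t) *: Z) @[M --> \oo] --> 0.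
  by under eq_fun do rewrite UZ; exact: cvg_cst.
have mtZ : measurable_wrt (F setT) (expR (- t) *: Z).
  rewrite -[_ *: _]addr0; apply: measurable_wrt_linear => //;
    exact: measurable_wrt_cst.
have := cvg_nsqB ipP (z := expR (- t) *: Z) (U_rep_cvg mtZ cZ).
under eq_fun do rewrite (nsqBC ipP) UZ.
move=> c0; rewrite (nsqBC ipP).
by apply: (cvg_unique (@norm_hausdorff _ _) c0); exact: cvg_cst.
Qed.

(** The eigenvalue relation also gives stability: [Z - U t Z] is [Z] times [1 - expR (- t)], up to a
    null vector. *)
Lemma additive_H1 a Z : A a -> additive_on A F a Z -> (H1 P F Am) Z.
Proof.
move=> Aa addZ; have UZ t := U_rep_additive t Aa addZ; have [mZ _] := addZ.
split; last first.
  by move=> t _; have /nsqB0_ae := UZ t; rewrite U_repE.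
split; first exact: sqint_Lfun.
apply: measurable_sigma_field_of; split.
  split; first exact: sqint_Lfun.
  by apply: measurable_wrt_sub mZ; apply: (F_mono algA FI) => //; exact: AT algA.
under eq_fun do rewrite -U_repE.
apply/L2dist_cvg.
have -> : (fun t => nsq (Z - U_rep t Z)) = (fun t => (1 - expR (- t)) ^+ 2 * nsq Z).
  apply/funext => t; rewrite -(nsqZ ipP) scalerBl scale1r.
  by rewrite !(nsqB ipP) (ipC ipP Z) (nsqB0_ip ipP _ (UZ t)) (ipC ipP _ Z) /nsq
     (nsqB0_ip ipP _ (UZ t)) (ipC ipP _ (U_rep t Z)) (nsqB0_ip ipP _ (UZ t)).
have c : 1 - expR (- t) @[t --> (0 : R)^'+] --> (0 : R).
  apply: cvg_at_right_filter; rewrite -[X in _ --> X](subrr (1 : R)).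
  apply: cvgB; first exact: cvg_cst.
  rewrite -[X in _ --> X](expR0 R) -[X in _ --> expR X](oppr0 R).
  by apply: continuous_cvg; [exact: continuous_expR|apply: cvgN; exact: cvg_id].
rewrite -[X in _ --> X](mul0r (nsq Z)); apply: cvgMl.
have h := cvgM c c; rewrite mulr0 in h; exact: h.
Qed.

Lemma CE_min G X Y : sub_sigma_field P G -> measurable_wrt G Y ->
  nsq (X - CE G X) <= nsq (X - Y).
Proof.
move=> GP mY; have h := nsq_ge0 ipP (Y - CE G X).
have e1 := CE_inner X GP mY; have e2 := CE_inner X GP (measurable_wrt_CE X GP).
move: h; rewrite !(nsqB ipP) (ipC ipP Y) e1 {2 4}/nsq e2; lra.
Qed.

Lemma stable_measurable G (f : Omega -> R) : sub_sigma_field P G ->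
  (forall m (j : J m), additive_field P A F (at_ j) `<=` G) ->
  L2 P (F setT) f -> L2dist P f (U P F Am t f) @[t --> 0^'+] --> 0%E ->
  measurable_wrt G f.
Proof.
move=> GP addG [Lf mf]; have fX := mk_sqintE Lf; move: mf; rewrite -fX;
  move: (mk_sqint P f).
move=> {Lf fX f} X mX.
under eq_fun do rewrite -U_repE.
move=> /L2dist_cvg stab.
suff : nsq (X - CE G X) = 0.
  by rewrite (nsqBC ipP); exact: measurable_wrt_sqint (measurable_wrt_CE X GP).
apply/eqP; rewrite eq_le (nsq_ge0 ipP) andbT.
have [X0|X0] := eqVneq (nsq X) 0.
  by rewrite -X0 -[X in _ <= nsq X]subr0; apply: CE_min => //;
    exact: measurable_wrt_cst.
have Xpos : 0 < nsq X by rewrite lt_def X0 (nsq_ge0 ipP).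
apply/ler_addgt0Pr => eps eps0; rewrite add0r.
(* The bound [eps / 4] absorbs the factor 4 of [stable_approx]. The bound [nsq X] excludes the junk
   value: if [U_rep t X] were 0, the squared distance would be [nsq X] itself. *)
have del0 : 0 < Num.min (eps / 4) (nsq X) by rewrite lt_min Xpos divr_gt0.
have /cvgrPdist_lt/(_ _ del0) small := stab.
have [t [/= tsmall t0]] := @filter_ex R (0^'+)
  _ _ (filterI small (nbhs_right_gt (0 : R))).
move: tsmall; rewrite sub0r normrN ger0_norm ?(nsq_ge0 ipP)// lt_min => /andP[te tX].
have [UX|U0] := U_rep_dichotomy t X; last by rewrite U0 subr0 ltxx in tX.
have rho0 : 0 < expR (- t) by exact: expR_gt0.
have rho1 : expR (- t) < 1 by rewrite expR_lt1 oppr_lt0.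
have bound m : nsq (X - CE G X) <= 4 * nsq (X - U_rep t X) +
    4 / ((expR (- t))^-1 - 1) ^+ 2 *
    nsq (weighted (e m) (expR (- t)) id X - U_rep t X).
  have [Y [mY Ysp] YX] := stable_approx m X.
  have mYG : measurable_wrt G Y.
    have [_ dis cov _ _] := basis m.
    apply: (sparse_measurable algA FP FI _ dis cov Ysp mY GP (addG m)) => j.
    exact/Am_sub/(atom_mem (basis m)).
  apply: (le_trans (CE_min X GP mYG)).
  have := YX _ _ rho0 rho1 UX.
  have XE : nsq (X - E setT X) = 0 by apply: CE_id mX; exact/FP/(AT algA).
  have swap W : nsq (E setT X - W) = nsq (X - W).
    rewrite !(nsqB ipP) (nsqB0_ip ipP W XE) {1 3}/nsq (nsqB0_ip ipP X XE)
      (ipC ipP _ X).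
    by rewrite (nsqB0_ip ipP _ XE).
  by rewrite !swap.
have lim : 4 * nsq (X - U_rep t X) + 4 / ((expR (- t))^-1 - 1) ^+ 2 *
    nsq (weighted (e m) (expR (- t)) id X - U_rep t X) @[m --> \oo] -->
    4 * nsq (X - U_rep t X) + 4 / ((expR (- t))^-1 - 1) ^+ 2 * 0.
  by apply: cvgD; [exact: cvg_cst|exact: cvgMr].
apply: (@le_trans _ _ (4 * nsq (X - U_rep t X) + 4 / ((expR (- t))^-1 - 1) ^+ 2 * 0)).
  apply: (ler_cvg_to _ lim); first exact: (cvg_cst (nsq (X - CE G X))).
  exact: nearW.
by rewrite mulr0 addr0; move: te; rewrite ltr_pdivlMr// mulrC => /ltW.
Qed.

End stable.

Theorem theorem2p12 (R : realType) (d : measure_display)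
    (Omega : measurableType d) (P : probability Omega R)
    (T : Type) (A : set (set T)) (F : set T -> set (set Omega))
    (Am : nat -> set (set T)) :
  set_algebra A ->
  countable A ->
  (forall a, A a -> sub_sigma_field P (F a)) ->
  (forall a b, A a -> A b -> a `&` b = set0 ->
     independent_fields P (F a) (F b) /\
     F (a `|` b) = gen_sigma_field P (F a `|` F b)) ->
  exhaustion A Am ->
  sigma_field_of P (H1 P F Am) = F_stable P F Am.
Proof.
move=> algA _ FP FI exhA.
have /choice[f basis] : forall m, exists p : {I : finType & I -> set T},
    atom_basis (Am m) (projT2 p).
  move=> m; have [/(_ m)[algm finm] _ _] := exhA.
  have [I [at_ basis]] := atom_basis_exists algm finm.
  by exists (existT _ I at_).
pose J m := projT1 (f m); pose at_ m : J m -> set T := projT2 (f m).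
have L2m G g : L2 P G g -> measurable_fun setT g.
  by move=> [/andP[+ _] _]; rewrite inE.
have stableP : sub_sigma_field P (F_stable P F Am).
  by apply: sigma_field_of_sub_sigma_field => g [/L2m].
have H1P : sub_sigma_field P (sigma_field_of P (H1 P F Am)).
  by apply: sigma_field_of_sub_sigma_field => g [/L2m].
apply/seteqP; split.
  by apply: sigma_field_of_min => // g [[_ mg] _].
apply: sigma_field_of_min => // g [L2g gstab].
(* Here [G] is the field generated by [H1]; it contains the additive field of each atom because
   additive elements belong to [H1]. *)
apply: (stable_measurable (at_ := at_) algA FP FI exhA basis H1P _ L2g gstab) => m j.
apply: (additive_field_sub H1P) => Z addZ; apply: measurable_sigma_field_of.
apply: (additive_H1 algA FP FI exhA basis _ addZ).
exact: (Am_sub exhA (atom_mem (basis m) j)).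
Qed.
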